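(* Let $\Delta$ be a balanced normal pseudomanifold of dimension $d-1\ge 2$. If the geometric realization $\|\Delta\|$ has a connected $t$-sheeted covering space, then $\overline{g}_2(\Delta)\ge 4\frac{t-1}{t}\binom{d}{2}$. In particular, if $\beta_1(\Delta;\mathbb{Q})\neq 0$, then $\overline{g}_2(\Delta)\ge 4\binom{d}{2}$.
   Context: Balanced: the graph of the $(d-1)$-dimensional complex admits a proper coloring with $d$ colors (no face contains two vertices of the same color). Normal $(d-1)$-pseudomanifold: connected, pure, every $(d-2)$-face lies in exactly two facets, links of faces of dimension $\le d-3$ connected. $h_j(\Delta)=\sum_{i=0}^{j}(-1)^{j-i}\binom{d-i}{d-j}f_{i-1}(\Delta)$ where $f_{i-1}$ counts $(i-1)$-faces ($f_{-1}=1$), and $\overline{g}_2(\Delta)=2h_2(\Delta)-(d-1)h_1(\Delta)$. $\beta_1(\Delta;\mathbb{Q})$ is the first reduced Betti number over $\mathbb{Q}$. *)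

(* Defs.v *)
From HB Require Import structures.
From mathcomp Require Import all_boot all_order all_algebra.

Set Implicit Arguments.
Unset Strict Implicit.
Unset Printing Implicit Defensive.

Import Order.TTheory GRing.Theory Num.Theory.

Local Open Scope ring_scope.

(* A complex is a family K of subsets of a finite type V. An element v of V is
   a vertex of K only if [set v] is in K; V may contain further elements. The
   empty face always belongs to K, and a face s has dimension #|s| - 1. *)
Section Complexes.
Variable V : finType.
Implicit Types (K : {set {set V}}) (s t : {set V}) (d : nat).

Definition simplicial_complex K : Prop :=
  set0 \in K /\ (forall s t, t \in K -> s \subset t -> s \in K).

(* The faces with n vertices, that is, of dimension n - 1. *)
Definition faces K (n : nat) : {set {set V}} := [set s in K | #|s| == n].

Definition facets K : {set {set V}} :=
  [set s in K | [forall t in K, (s \subset t) ==> (t == s)]].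

Definition link K s : {set {set V}} :=
  [set t in K | [disjoint s & t] && (s :|: t \in K)].

Definition edge_rel K : rel V := fun u v => (u != v) && ([set u; v] \in K).

Definition connected_complex K : Prop :=
  forall u v, [set u] \in K -> [set v] \in K -> connect (edge_rel K) u v.

(* Every facet has d vertices: pure of dimension d - 1. *)
Definition pure_complex d K : Prop := forall s, s \in facets K -> #|s| = d.

(* d is the number of vertices of a facet, so the dimension is d - 1. *)
Definition normal_pseudomanifold d K : Prop :=
  [/\ simplicial_complex K,
      connected_complex K,
      pure_complex d K,
      forall s, s \in K -> (#|s| = d - 1)%N ->
        #|[set F in facets K | s \subset F]| = 2%N
    & forall s, s \in K -> (#|s| <= d - 2)%N -> connected_complex (link K s)].

Definition balanced d K : Prop :=
  exists kappa : V -> 'I_d, forall u v, edge_rel K u v -> kappa u != kappa v.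

(* #|faces K i| is f_(i - 1). *)
Definition hnum d K (j : nat) : int :=
  \sum_(i < j.+1)
    (-1) ^+ (j - i) * ('C(d - i, d - j))%:Z * #|faces K i|%:Z.

Definition g2bar d K : int := 2 * hnum d K 2 - (d%:Z - 1) * hnum d K 1.

(* The coefficient of t in the boundary of s, both oriented by the enumeration
   order of V: (-1) to the position of v in s if t = s - v, and 0 otherwise. *)
Definition incidence s t : rat :=
  \sum_(v in s | s :\ v == t)
    (-1) ^+ #|[set u in s | (enum_rank u < enum_rank v)%N]|.

(* The boundary C_n -> C_(n - 1) acting on row vectors. For n = 0 it is the
   augmentation, which gives reduced homology. *)
Definition boundary_mx K (n : nat) : 'M[rat]_(#|faces K n.+1|, #|faces K n|) :=
  \matrix_(i, j) incidence (enum_val i) (enum_val j).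

(* The dimension of Z_n / B_n; as B_n lies in Z_n, nothing is truncated. *)
Definition betti K (n : nat) : nat :=
  (\rank (kermx (boundary_mx K n)) - \rank (boundary_mx K n.+1))%N.

End Complexes.

From mathcomp Require Import all_classical all_reals all_analysis.
Import numFieldNormedType.Exports.

Local Open Scope classical_set_scope.

(* Barycentric coordinates, with the topology induced from R^V. *)
Definition realization_set (R : realType) (V : finType) (K : {set {set V}}) :
    set {ptws V -> R} :=
  [set x | [/\ forall v, 0 <= x v, \sum_v x v = 1
             & finset (fun v => x v != 0) \in K]].

Definition realization (R : realType) (V : finType) (K : {set {set V}}) :
    topologicalType := set_type (@realization_set R V K).

Section Coverings.
Variables E B : topologicalType.
Implicit Types (p : E -> B) (A : set E) (U : set B).

Definition homeomorphism_on p A U : Prop :=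
  exists g : B -> E,
    [/\ set_fun A U p, set_fun U A g,
        (forall x, A x -> g (p x) = x) /\ (forall y, U y -> p (g y) = y),
        {within A, continuous p}
      & {within U, continuous g}].

Definition evenly_covered p U : Prop :=
  exists S : set (set E),
    [/\ forall A, S A -> open A,
        forall A A', S A -> S A' -> A `&` A' !=set0 -> A = A',
        \bigcup_(A in S) A = p @^-1` U
      & forall A, S A -> homeomorphism_on p A U].

Definition covering_map p : Prop :=
  continuous p /\
  forall y, exists U, [/\ open U, U y & evenly_covered p U].

Definition sheeted (t : nat) p : Prop :=
  forall y, (p @^-1` [set y] #= `I_t)%card.

End Coverings.

Definition has_connected_covering (B : topologicalType) (t : nat) : Prop :=
  exists (E : topologicalType) (p : E -> B),
    [/\ connected [set: E], covering_map p & sheeted t p].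

(* Main.v *)
(** A balanced complex is a union of three-coloured parts, so the inequality is
    a sum over triples of colours of the bound [e >= 3 n - 6] for the subgraph
    spanned by three colours.  That bound holds because the subgraph is rigid
    for Kalai's hyperconnectivity: a framework assigns to every vertex a vector
    [p v] of [rat^3], a motion [m] satisfies [m u . p v = m v . p u] on edges, and
    rigid means that all motions are [p u *m A] with [A] symmetric.  Following
    Fogelsanger, minimal 2-cycles modulo 2 are rigid, by contracting an edge and
    cutting the contracted cycle into minimal ones; the link of a face carrying
    the remaining colours is such a cycle near each of its triangles, and ridge
    crossings glue these cycles together.

    Applied to a connected [t]-sheeted cover, which is again a balanced normal
    pseudomanifold with [t] times as many vertices and edges, the inequality
    improves to the stated one.  A topological covering is turned into a
    simplicial one by lifting segments in small steps, below a Lebesgue number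
    of the covering.  If the first Betti number is nonzero, an integral 1-cocycle
    with a nonzero period [m] gives connected cyclic covers with [N m + 1] sheets
    for all [N]. *)
Require Import Defs.
From HB Require Import structures.
From mathcomp Require Import all_boot all_order all_algebra.
From mathcomp Require Import boolp.
From mathcomp Require Import zify.

Set Implicit Arguments.
Unset Strict Implicit.
Unset Printing Implicit Defensive.

Import Order.TTheory GRing.Theory Num.Theory.

(** * Hyperconnectivity of graphs *)

Section LinearAlgebra.
Local Open Scope ring_scope.

(** The equation of an edge keeps its content when both ends are placed at the same point, where a
    bar of length zero would impose nothing; with hyperconnectivity an edge can therefore be
    contracted without limits of directions. The 6 in the bound is the dimension of the space of
    symmetric 3 by 3 matrices. Cycles modulo 2 replace surfaces because contracting an edge may
    pinch a surface, whereas a cycle remains a cycle and only has to be cut again. Expanding the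
    h-numbers gives g2bar = 2 f_1 - 3 (d - 1) f_0 + 4 C(d, 2), so the bound for balanced complexes
    says g2bar >= 0, and a cover with n sheets multiplies everything but the last term by n.
    Dividing by n leaves the defect 4 C(d, 2) / n, which is the origin of the factor (t - 1) / t. As
    g2bar is an integer, the defect disappears once n exceeds 4 C(d, 2); this is why cyclic covers
    with arbitrarily many sheets are wanted. *)

Lemma poly_neq0_nonroot (f : {poly rat}) : f != 0 -> exists s, f.[s] != 0.
Proof.
move=> f0; pose rs := [seq (i%:R : rat) | i <- iota 0 (size f)].
have urs : uniq rs by rewrite map_inj_uniq ?iota_uniq //; apply: mulrIn.
case: (boolP (all (root f) rs)) => [rr|/allPn [s _ hs]]; last by exists s.
by have := max_poly_roots f0 rr urs; rewrite size_map size_iota ltnn.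
Qed.

Import VectorInternalTheory.

(** With [N] the composite of [M1] and a left inverse of [M0], a zero of [L0 + s L1] is a zero of
    [1 + s N]. This endomorphism has a determinant even if [L0] and [L1] are not square, and the
    determinant is a polynomial in [s] with value 1 at 0. *)
Lemma linear_inj_open (aT rT : vectType rat) (L0 L1 : {linear aT -> rT}) :
  (forall x, L0 x = 0 -> x = 0) ->
  exists f : {poly rat}, f.[0] != 0 /\
    forall s, f.[s] != 0 -> forall x, L0 x + s *: L1 x = 0 -> x = 0.
Proof.
move=> inj.
pose M0 := linfun L0; pose M1 := linfun L1.
have ker0 : lker M0 == 0%VS.
  apply/lker0P => x y; rewrite !lfunE /= => /eqP.
  by rewrite -subr_eq0 -linearB /= => /eqP/inj/eqP; rewrite subr_eq0 => /eqP.
pose N : 'End(aT) := (M0^-1 \o M1)%VF.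
pose B := \matrix_(i, j) (1%:M i j)%:P + 'X *: map_mx polyC (lin1_mx (v2r \o N \o r2v)).
have evB s : (\det B).[s] = \det (1%:M + s *: lin1_mx (v2r \o N \o r2v)).
  rewrite -horner_evalE -det_map_mx; congr (\det _).
  by apply/matrixP => i j; rewrite !mxE /= /horner_eval !hornerE.
exists (\det B); split; first by rewrite evB scale0r addr0 det1 oner_eq0.
move=> s; rewrite evB => hs x hx.
have hN : x + s *: N x = 0.
  have : (M0^-1)%VF (L0 x + s *: L1 x) = 0 by rewrite hx linear0.
  rewrite linearD linearZ /=.
  have -> : L0 x = M0 x by rewrite lfunE.
  by rewrite lker0_lfunK // => e; rewrite -[RHS]e comp_lfunE /= (lfunE L1).
have um : 1%:M + s *: lin1_mx (v2r \o N \o r2v) \in unitmx by rewrite unitmxE unitfE.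
apply: (can_inj v2rK); rewrite linear0.
apply: (can_inj (mulmxK um)); rewrite mul0mx mulmxDr mulmx1 -scalemxAr.
rewrite mul_rV_lin1 /= v2rK -linearZ -linearD /=.
by rewrite hN linear0.
Qed.

Lemma linear_inj_dim (aT rT : vectType rat) (L : {linear aT -> rT}) :
  (forall x, L x = 0 -> x = 0) -> (dim aT <= dim rT)%N.
Proof.
move=> inj.
have ker0 : lker (linfun L) == 0%VS.
  apply/lker0P => x y; rewrite !lfunE /= => /eqP.
  by rewrite -subr_eq0 -linearB /= => /eqP/inj/eqP; rewrite subr_eq0 => /eqP.
have := limg_ker_dim (linfun L) fullv.
rewrite (eqP ker0) capv0 dimv0 add0n => hdim.
by have := dimvS (subvf (limg (linfun L))); rewrite hdim !dimvf.
Qed.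


End LinearAlgebra.

(** * Frameworks, motions and generic rigidity in dimension three *)

Section Rigidity.
Local Open Scope ring_scope.

Definition dot (x y : 'rV[rat]_3) : rat := (x *m y^T) 0 0.

Lemma dotC x y : dot x y = dot y x.
Proof. by rewrite /dot !mxE; apply: eq_bigr => i _; rewrite !mxE mulrC. Qed.

Lemma dotDl x y z : dot (x + y) z = dot x z + dot y z.
Proof. by rewrite /dot mulmxDl mxE. Qed.

Lemma dotZl a x y : dot (a *: x) y = a * dot x y.
Proof. by rewrite /dot -scalemxAl mxE. Qed.

Lemma dotBl x y z : dot (x - y) z = dot x z - dot y z.
Proof. by rewrite -scaleN1r dotDl dotZl mulN1r. Qed.

Lemma dotDr x y z : dot x (y + z) = dot x y + dot x z.
Proof. by rewrite dotC dotDl !(dotC _ x). Qed.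

Lemma dotZr a x y : dot x (a *: y) = a * dot x y.
Proof. by rewrite dotC dotZl dotC. Qed.

Lemma dot_sym_mx x y (A : 'M_3) : A^T = A -> dot (x *m A) y = dot (y *m A) x.
Proof. by move=> sA; rewrite dotC /dot trmx_mul sA mulmxA. Qed.

Variable V : finType.
Implicit Types (E : rel V) (U : {set V}) (p q m : {ffun V -> 'rV[rat]_3}).
Implicit Types (a b c u v w x y : V).

Definition tri p a b c : 'M[rat]_3 :=
  \matrix_(i < 3) p (tnth [tuple a; b; c] i).

Definition indep p a b c := tri p a b c \in unitmx.

Lemma triP p q a b c (A : 'M_3) :
  tri p a b c *m A = tri q a b c <->
  [/\ p a *m A = q a, p b *m A = q b & p c *m A = q c].
Proof.
split=> [e|[ea eb ec]].
  have h i : p (tnth [tuple a; b; c] i) *m A = q (tnth [tuple a; b; c] i).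
    by have := congr1 (row i) e; rewrite row_mul !rowK.
  by split; [exact: (h 0) | exact: (h 1) | exact: (h 2)].
apply/row_matrixP => i; rewrite row_mul !rowK.
by case: i => [[|[|[|//]]] hi]; rewrite !(tnth_nth a).
Qed.

Lemma indep_sym_inj p a b c (A B : 'M_3) : indep p a b c ->
  p a *m A = p a *m B -> p b *m A = p b *m B -> p c *m A = p c *m B -> A = B.
Proof.
move=> i ea eb ec; apply: (can_inj (mulKmx i)).
apply/row_matrixP => j; rewrite !row_mul !rowK.
by case: j => [[|[|[|//]]] hj]; rewrite !(tnth_nth a).
Qed.

Lemma indep_orth p a b c (r : 'rV_3) : indep p a b c ->
  dot r (p a) = 0 -> dot r (p b) = 0 -> dot r (p c) = 0 -> r = 0.
Proof.
move=> i ea eb ec; apply: (can_inj (@mulmxK _ _ _ (tri p a b c)^T _)).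
  by rewrite unitmx_tr.
rewrite mul0mx; apply/rowP => j; rewrite [RHS]mxE.
rewrite -[LHS]/((r *m (tri p a b c)^T) 0 j).
have -> : (r *m (tri p a b c)^T) 0 j = dot r (p (tnth [tuple a; b; c] j)).
  by rewrite /dot !mxE; apply: eq_bigr => k _; rewrite !mxE.
by case: j => [[|[|[|//]]] hj]; rewrite !(tnth_nth a).
Qed.

Definition motion p U E m :=
  forall u v, u \in U -> v \in U -> E u v -> dot (m u) (p v) = dot (m v) (p u).

Definition rigid p U E := forall m, motion p U E m ->
  exists2 A : 'M_3, A^T = A & forall u, u \in U -> m u = p u *m A.

Lemma rigid_mono p U E E' :
  (forall u v, u \in U -> v \in U -> E u v -> E' u v) ->
  rigid p U E -> rigid p U E'.
Proof. by move=> sE r m hm; apply: r => u v uU vU /sE-/(_ uU vU); apply: hm. Qed.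

(** Let P and M have as rows the values of [p] and [m] at the triangle. Only A = P^-1 M is possible.
    The three edge equations say that M P^T is symmetric, and so is then P^-1 (M P^T) P^-T = A. *)
Lemma motion_triangle p U E m a b c : motion p U E m -> indep p a b c ->
  [&& a \in U, b \in U & c \in U] -> [&& E a b, E b c & E a c] ->
  exists2 A : 'M_3, A^T = A & [/\ m a = p a *m A, m b = p b *m A & m c = p c *m A].
Proof.
move=> hm i /and3P[aU bU cU] /and3P[ab bc ac].
pose A := invmx (tri p a b c) *m tri m a b c.
have eA : tri p a b c *m A = tri m a b c by rewrite /A mulKVmx.
exists A; last by case/triP: eA.
have hS : tri m a b c *m (tri p a b c)^T = tri p a b c *m (tri m a b c)^T.
  apply/matrixP => j k.
  have -> : (tri m a b c *m (tri p a b c)^T) j k =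
     dot (m (tnth [tuple a; b; c] j)) (p (tnth [tuple a; b; c] k)).
    by rewrite /dot !mxE; apply: eq_bigr => l _; rewrite !mxE.
  have -> : (tri p a b c *m (tri m a b c)^T) j k =
     dot (p (tnth [tuple a; b; c] j)) (m (tnth [tuple a; b; c] k)).
    by rewrite /dot !mxE; apply: eq_bigr => l _; rewrite !mxE.
  rewrite [RHS]dotC.
  have [[hab hbc] hac] := (hm _ _ aU bU ab, hm _ _ bU cU bc, hm _ _ aU cU ac).
  by case: j => [[|[|[|//]]] hj]; case: k => [[|[|[|//]]] hk];
     rewrite !(tnth_nth a).
have iT : (tri p a b c)^T \in unitmx by rewrite unitmx_tr.
apply: (can_inj (mulKmx i)); apply: (can_inj (mulmxK iT)).
by rewrite eA hS -[in RHS]eA (trmx_mul (tri p a b c)) mulmxA.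
Qed.

Lemma rigid_triangle p E a b c : indep p a b c ->
  [&& E a b, E b c & E a c] -> rigid p [set a; b; c] E.
Proof.
move=> i hE m hm.
have [|A sA [ea eb ec]] := motion_triangle hm i _ hE; first by rewrite !inE !eqxx !orbT.
by exists A => // u; rewrite !inE => /orP[/orP[]|] /eqP->.
Qed.

Lemma rigid_glue p U1 U2 E a b c : indep p a b c ->
  [&& a \in U1, b \in U1 & c \in U1] -> [&& a \in U2, b \in U2 & c \in U2] ->
  rigid p U1 E -> rigid p U2 E -> rigid p (U1 :|: U2) E.
Proof.
move=> i /and3P[a1 b1 c1] /and3P[a2 b2 c2] r1 r2 m hm.
have [|A1 sA1 h1] := r1 m.
  by move=> u v uU vU; apply: hm; rewrite inE ?uU ?vU.
have [|A2 sA2 h2] := r2 m.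
  by move=> u v uU vU; apply: hm; rewrite inE ?uU ?vU orbT.
have eA : A1 = A2.
  by apply: (indep_sym_inj i); rewrite -h1 // -h2.
exists A1 => // u; rewrite inE => /orP[]; first exact: h1.
by rewrite eA; apply: h2.
Qed.

Definition contract u v x := if x == v then u else x.

(* Putting both ends of the contracted edge at the same point already gives a
   rigid framework: the constraints of [uv] and of the two common neighbours
   force the two ends to move together. *)
Lemma rigid_split p U E E' u v a b : p u = p v -> indep p u a b ->
  [&& u \in U, v \in U, a \in U & b \in U] ->
  [&& E u v, E u a, E v a, E u b & E v b] -> u != v ->
  (forall x y, x \in U :\ v -> y \in U :\ v -> E' x y ->
     exists x' y', [/\ x' \in U, y' \in U, contract u v x' = x,
                       contract u v y' = y & E x' y']) ->
  rigid p (U :\ v) E' -> rigid p U E.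
Proof.
move=> epuv i /and4P[uU vU aU bU] /and5P[uv ua va ub vb] neuv hE r m hm.
have emuv : m u = m v.
  apply/eqP; rewrite -subr_eq0; apply/eqP/(indep_orth i); rewrite dotBl.
  - by rewrite {1}epuv hm // subrr.
  - by rewrite (hm u a) // (hm v a) // epuv subrr.
  - by rewrite (hm u b) // (hm v b) // epuv subrr.
have pc x : p (contract u v x) = p x by rewrite /contract; case: eqP => // ->.
have mc x : m (contract u v x) = m x by rewrite /contract; case: eqP => // ->.
have [x y xU yU /hE|A sA hA] := r m.
  by case=> // x' [y' [x'U y'U <- <- e]]; rewrite !pc !mc hm.
exists A => // x xU; have [->|nx] := eqVneq x v.
  by rewrite -emuv -epuv; apply: hA; rewrite !inE neuv.
by apply: hA; rewrite !inE nx.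
Qed.

(** Rigidity as the vanishing of a kernel: fixing an independent triangle removes exactly the
    trivial motions. In this form it is the injectivity of a linear map depending affinely on [p],
    which survives perturbation. *)
Definition pinned p U E a b c := forall m, motion p U E m ->
  m a = 0 -> m b = 0 -> m c = 0 -> forall u, u \in U -> m u = 0.

Lemma rigid_pinned p U E a b c : indep p a b c ->
  [&& a \in U, b \in U & c \in U] -> rigid p U E -> pinned p U E a b c.
Proof.
move=> i /and3P[aU bU cU] r m /r [A sA h] ma mb mc u uU.
have A0 : A = 0.
  by apply: (indep_sym_inj i); rewrite -h // mulmx0.
by rewrite h // A0 mulmx0.
Qed.

Lemma pinned_rigid p U E a b c : indep p a b c ->
  [&& a \in U, b \in U & c \in U] -> [&& E a b, E b c & E a c] ->
  pinned p U E a b c -> rigid p U E.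
Proof.
move=> i hU hE pin m hm.
have [A sA [ea eb ec]] := motion_triangle hm i hU hE.
exists A => // u uU; apply/eqP; rewrite -subr_eq0; apply/eqP.
pose m' := [ffun x => m x - p x *m A].
have -> : m u - p u *m A = m' u by rewrite ffunE.
apply: pin uU; last 3 first.
- by rewrite ffunE ea subrr.
- by rewrite ffunE eb subrr.
- by rewrite ffunE ec subrr.
move=> x y xU yU exy; rewrite !ffunE !dotBl hm //.
by congr (_ - _); rewrite dot_sym_mx.
Qed.

(** A substitute for Zariski openness: on a line through a point of [P], only roots of a polynomial
    that is nonzero at that point may fail. Over an infinite field two nonempty sets of this kind
    meet, already on a line joining a point of each. *)
Definition open_along_lines (P : {ffun V -> 'rV[rat]_3} -> Prop) :=
  forall p q, P p -> exists f : {poly rat}, f.[0] != 0 /\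
    forall s, f.[s] != 0 -> P (p + s *: (q - p)).

Lemma open_meet P Q : open_along_lines P -> open_along_lines Q ->
  (exists p, P p) -> (exists p, Q p) -> exists p, P p /\ Q p.
Proof.
move=> oP oQ [p Pp] [q Qq].
have [f [f0 hf]] := oP p q Pp; have [g [g0 hg]] := oQ q p Qq.
(* Seen from [q], the parameter of the same line is [1 - s]. *)
pose h := f * (g \Po (1 - 'X)).
have h0 : h != 0.
  rewrite mulf_neq0 //; first by apply: contraNneq f0 => ->; rewrite horner0.
  apply: contraNneq g0 => e.
  have := congr1 (fun r : {poly rat} => r.[1]) e.
  by rewrite /= horner_comp !hornerE subrr => ->.
have [s] := poly_neq0_nonroot h0.
rewrite hornerM horner_comp !hornerE mulf_eq0 negb_or => /andP[/hf Ps /hg Qs].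
exists (p + s *: (q - p)); split => //.
congr (Q _): Qs.
by rewrite scalerBl scale1r addrA subrKC -scalerN opprB.
Qed.

Lemma indep_open a b c : open_along_lines (fun p => indep p a b c).
Proof.
move=> p q; rewrite /indep unitmxE unitfE => i.
pose B := map_mx polyC (tri p a b c) + 'X *: map_mx polyC (tri (q - p) a b c).
have evB s : (\det B).[s] = \det (tri (p + s *: (q - p)) a b c).
  rewrite -horner_evalE -det_map_mx; congr (\det _).
  apply/matrixP => j k; rewrite !mxE /= /horner_eval !hornerE !ffunE !mxE.
  by rewrite mulrDr.
exists (\det B); split; first by rewrite evB scale0r addr0.
by move=> s; rewrite evB unitmxE unitfE.
Qed.

Lemma open_all (I : eqType) (r : seq I) (P : I -> {ffun V -> 'rV[rat]_3} -> Prop) :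
  (forall i, open_along_lines (P i)) ->
  open_along_lines (fun p => forall i, i \in r -> P i p).
Proof.
move=> oP p q Pp; elim: r Pp => [|i r ih] Pp.
  by exists 1; split => //; rewrite hornerC oner_eq0.
have [j jr|f [f0 hf]] := ih; first by apply: Pp; rewrite inE jr orbT.
have [g [g0 hg]] := oP i p q (Pp i (mem_head _ _)).
exists (f * g); split; first by rewrite hornerM mulf_neq0.
move=> s; rewrite hornerM mulf_eq0 negb_or => /andP[/hf Ps /hg Qs] j.
by rewrite inE => /predU1P[->//|]; apply: Ps.
Qed.

(** Indexed by a finite list of triples so that [open_all] applies; [gen_posP] gives the usual
    form. *)
Definition gen_pos p := forall abc : V * V * V,
  abc \in [seq w <- enum {: V * V * V} | [&& w.1.1 != w.1.2, w.1.2 != w.2 & w.1.1 != w.2]] ->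
  indep p abc.1.1 abc.1.2 abc.2.

Lemma gen_posP p : gen_pos p <->
  forall a b c, a != b -> b != c -> a != c -> indep p a b c.
Proof.
split=> [h a b c ab bc ac|h [[a b] c]].
  by apply: (h (a, b, c)); rewrite mem_filter mem_enum /= ab bc ac.
by rewrite mem_filter => /andP[/and3P[ab bc ac] _]; apply: h.
Qed.

Lemma gen_pos_open : open_along_lines gen_pos.
Proof.
by apply: open_all => abc; apply: indep_open.
Qed.

(** Points (1, z, z^2) of the moment curve with distinct z: any three have a nonzero Vandermonde
    determinant. *)
Lemma gen_pos_exists : exists p, gen_pos p.
Proof.
pose z (v : V) : rat := (enum_rank v)%:R.
have zI u v : u != v -> z v - z u != 0.
  rewrite subr_eq0 eqr_nat; apply: contraNN => /eqP/ord_inj e.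
  by rewrite (enum_rank_inj e).
exists [ffun v => \row_(i < 3) z v ^+ i]; apply/gen_posP => a b c ab bc ac.
rewrite /indep unitmxE unitfE -det_tr.
have -> : (tri [ffun v => \row_i z v ^+ i] a b c)^T =
    Vandermonde 3 (\row_(i < 3) z (tnth [tuple a; b; c] i)).
  by apply/matrixP => i j; rewrite !mxE ffunE mxE.
rewrite det_Vandermonde; apply/prodf_neq0 => i _; apply/prodf_neq0 => j.
case: i => [[|[|[|//]]] hi]; case: j => [[|[|[|//]]] hj] //= _;
by rewrite !mxE !(tnth_nth a) /= zI.
Qed.

Section Open.
Variables (U : {set V}) (E : rel V) (a b c : V).

(** The second component also records [m] outside [U]: motions are functions on all of [V], and
    these values, on which no edge equation bears, would otherwise lie in the kernel. *)
Definition pin_map p m : {ffun V * V -> rat^o} * {ffun V -> 'rV[rat]_3} :=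
  ([ffun w => if [&& w.1 \in U, w.2 \in U & E w.1 w.2] then
                dot (m w.1) (p w.2) - dot (m w.2) (p w.1) else 0],
   [ffun v => if v \in U :\: [set a; b; c] then 0 else m v]).

Fact pin_map_linear p : linear (pin_map p).
Proof.
move=> k m m'; congr pair; apply/ffunP => w; rewrite !ffunE.
  case: ifP => _; last by rewrite scaler0 addr0.
  by rewrite !dotDl !dotZl /GRing.scale /= mulrBr opprD addrACA.
by case: ifP => _ //; rewrite scaler0 addr0.
Qed.
HB.instance Definition _ p := GRing.isLinear.Build rat _ _ _ (pin_map p) (pin_map_linear p).

(** The derivative of [pin_map] with respect to [p]; the pinned values do not depend on [p], whence
    the 0. *)
Definition pin_dmap q m : {ffun V * V -> rat^o} * {ffun V -> 'rV[rat]_3} :=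
  ((pin_map q m).1, 0).

Fact pin_dmap_linear q : linear (pin_dmap q).
Proof.
by move=> k m m'; rewrite /pin_dmap linearP /= -[RHS]/(_, _) /= scaler0 addr0.
Qed.
HB.instance Definition _ q := GRing.isLinear.Build rat _ _ _ (pin_dmap q) (pin_dmap_linear q).

Lemma pin_mapD p q s m : pin_map (p + s *: q) m = pin_map p m + s *: pin_dmap q m.
Proof.
congr pair; last by rewrite /= scaler0 addr0.
apply/ffunP => w; rewrite !ffunE; case: ifP => _; last by rewrite scaler0 addr0.
by rewrite !dotDr !dotZr /GRing.scale /= mulrBr opprD addrACA.
Qed.

Lemma pinned_inj p : [&& a \in U, b \in U & c \in U] ->
  pinned p U E a b c <-> forall m, pin_map p m = 0 -> m = 0.
Proof.
move=> /and3P[aU bU cU]; split.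
  move=> pin m [e1 e2].
  have out v : v \notin U :\: [set a; b; c] -> m v = 0.
    by move=> hv; move/ffunP/(_ v): e2; rewrite !ffunE (negbTE hv).
  apply/ffunP => u; rewrite ffunE; case: (boolP (u \in U)) => hu; last first.
    by apply: out; rewrite inE (negbTE hu) andbF.
  apply: pin hu; last 3 first.
  - by apply: out; rewrite !inE eqxx.
  - by apply: out; rewrite !inE eqxx orbT.
  - by apply: out; rewrite !inE eqxx !orbT.
  move=> x y xU yU exy; move/ffunP/(_ (x, y)): e1.
  by rewrite !ffunE /= xU yU exy /= => /eqP; rewrite subr_eq0 => /eqP.
move=> inj m hm ma mb mc u uU.
pose m' := [ffun v => if v \in U then m v else 0].
have -> : m u = m' u by rewrite ffunE uU.
rewrite (inj m') ?ffunE //; congr pair; apply/ffunP => w; rewrite !ffunE.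
  case: ifP => // /and3P[w1 w2 ew]; rewrite w1 w2 hm // subrr.
  by [].
case: ifP => // /negbT; rewrite !inE negb_and negbK.
case/orP=> [/orP[/orP[]|]/eqP->|/negbTE->] //; by rewrite ?aU ?bU ?cU.
Qed.

Lemma pinned_open : [&& a \in U, b \in U & c \in U] ->
  open_along_lines (fun p => pinned p U E a b c).
Proof.
move=> hU p q /(pinned_inj _ hU) inj.
have [f [f0 hf]] := linear_inj_open (pin_dmap (q - p)) inj.
exists f; split => // s /hf inj'; apply/pinned_inj => // m e; apply: inj'.
by rewrite -pin_mapD.
Qed.

End Open.

Definition triangle_in U E a b c :=
  [&& [&& a != b, b != c & a != c], [&& a \in U, b \in U & c \in U]
    & [&& E a b, E b c & E a c]].

(** One rigid framework in general position stands for all generic ones. The triangle belongs to the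
    notion because pinning it is what makes rigidity an open condition. *)
Definition grigid U E := (exists a b c, triangle_in U E a b c) /\
  exists p, gen_pos p /\ rigid p U E.

Lemma rigid_open U E a b c : triangle_in U E a b c ->
  open_along_lines (fun p => indep p a b c /\ rigid p U E).
Proof.
move=> /and3P[_ hU hE] p q [i r].
have [f [f0 hf]] := indep_open q i.
have [g [g0 hg]] := pinned_open hU q (rigid_pinned i hU r).
exists (f * g); split; first by rewrite hornerM mulf_neq0.
move=> s; rewrite hornerM mulf_eq0 negb_or => /andP[/hf is_ /hg pin].
by split=> //; apply: pinned_rigid pin.
Qed.

Lemma gen_pos_triangle p U E a b c : gen_pos p -> triangle_in U E a b c ->
  indep p a b c.
Proof. by move=> /gen_posP gp /and3P[/and3P[ab bc ac] _ _]; apply: gp. Qed.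

(* Rigidity is an open condition on frameworks, so one rigid framework can be
   moved into general position. *)
Lemma rigid_grigid p U E a b c : triangle_in U E a b c -> indep p a b c ->
  rigid p U E -> grigid U E.
Proof.
move=> T i r; split; first by exists a, b, c.
have [q [gq [iq rq]]] := open_meet gen_pos_open (rigid_open T) gen_pos_exists
  (ex_intro _ p (conj i r)).
by exists q.
Qed.

Lemma grigid_mono U E E' :
  (forall u v, u \in U -> v \in U -> E u v -> E' u v) ->
  grigid U E -> grigid U E'.
Proof.
move=> h [[a [b [c /and3P[n hU /and3P[ab bc ac]]]]] [p [gp r]]].
split; last by exists p; split=> //; apply: rigid_mono r.
exists a, b, c; apply/and3P; split=> //.
by move/and3P: hU => [aU bU cU]; rewrite !h.
Qed.

Lemma grigid_triangle E a b c : triangle_in [set a; b; c] E a b c ->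
  grigid [set a; b; c] E.
Proof.
move=> T; have [p gp] := gen_pos_exists.
apply: (rigid_grigid T (gen_pos_triangle gp T)).
by apply: rigid_triangle (gen_pos_triangle gp T) _; case/and3P: T.
Qed.

(** The two parts come with different frameworks. Openness yields one that is rigid on both and in
    general position, so the common triple is independent and forces the two symmetric matrices to
    agree. *)
Lemma grigid_glue U1 U2 E a b c : [&& a != b, b != c & a != c] ->
  [&& a \in U1, b \in U1 & c \in U1] -> [&& a \in U2, b \in U2 & c \in U2] ->
  grigid U1 E -> grigid U2 E -> grigid (U1 :|: U2) E.
Proof.
move=> /and3P[ab bc ac] h1 h2 [[a1 [b1 [c1 T1]]] [p1 [g1 r1]]] [[a2 [b2 [c2 T2]]] [p2 [g2 r2]]].
have {p1 g1 p2 g2 r1 r2}[q [[/gen_posP gq r1] [i2 r2]]] :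
    exists q, (gen_pos q /\ rigid q U1 E) /\ (indep q a2 b2 c2 /\ rigid q U2 E).
  have [|||q [[gq [i1' r1']] [i2' r2']]] := @open_meet
      (fun q => gen_pos q /\ (indep q a1 b1 c1 /\ rigid q U1 E)) _ _ (rigid_open T2).
  - move=> p' q' [g' ir'].
    have [f [f0 hf]] := gen_pos_open q' g'; have [g [g0 hg]] := rigid_open T1 q' ir'.
    exists (f * g); split; first by rewrite hornerM mulf_neq0.
    by move=> s; rewrite hornerM mulf_eq0 negb_or => /andP[/hf ? /hg ?].
  - by exists p1; split=> //; split=> //; apply: gen_pos_triangle T1.
  - by exists p2; split=> //; apply: gen_pos_triangle T2.
  by exists q.
have r : rigid q (U1 :|: U2) E by apply: (rigid_glue (gq _ _ _ ab bc ac)).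
have T : triangle_in (U1 :|: U2) E a2 b2 c2.
  case/and3P: T2 => n2 /and3P[aU bU cU] e2.
  by rewrite /triangle_in n2 e2 !inE aU bU cU !orbT.
exact: rigid_grigid T i2 r.
Qed.

(** Placing [v] on [u] gives a rigid framework that is not in general position. The triangle [x y z]
    keeps distinct corners after contraction, so it is still independent and [rigid_grigid] can
    perturb the framework. *)
Lemma grigid_split U E E' u v a b x y z : u != v ->
  [&& u \in U, v \in U, a \in U & b \in U] ->
  [&& E u v, E u a, E v a, E u b & E v b] ->
  [&& a != u, a != v, b != u, b != v & a != b] ->
  triangle_in U E x y z ->
  [&& contract u v x != contract u v y, contract u v y != contract u v z
    & contract u v x != contract u v z] ->
  (forall x y, x \in U :\ v -> y \in U :\ v -> E' x y ->
     exists x' y', [/\ x' \in U, y' \in U, contract u v x' = x,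
                       contract u v y' = y & E x' y']) ->
  grigid (U :\ v) E' -> grigid U E.
Proof.
move=> neuv hU hE /and5P[au av bu bv ab] T /and3P[nxy nyz nxz] hE' [_ [p [/gen_posP gp r]]].
pose p' := [ffun x => p (contract u v x)].
have cu : contract u v u = u by rewrite /contract (negbTE neuv).
have cn w : w != v -> contract u v w = w by rewrite /contract => /negbTE->.
have ip' d e f : tri p' d e f = tri p (contract u v d) (contract u v e) (contract u v f).
  apply/row_matrixP => j; rewrite !rowK ffunE.
  by case: j => [[|[|[|//]]] hj]; rewrite !(tnth_nth d).
apply: (@rigid_grigid p' _ _ x y z) => //; first by rewrite /indep ip'; apply: gp.
apply: (@rigid_split p' U E E' u v a b) => //.
- by rewrite !ffunE cu /contract eqxx.
- by rewrite /indep ip' cu !cn //; apply: gp; rewrite // eq_sym.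
move=> m hm; have [d e dU eU ed|A sA hA] := r m.
  have := hm d e dU eU ed; rewrite !ffunE.
  by move: dU eU; rewrite !inE => /andP[/cn-> _] /andP[/cn-> _].
exists A => // w wU; rewrite ffunE hA //.
by move: wU; rewrite !inE => /andP[/cn->].
Qed.

(** Pinning a triangle of a rigid framework leaves an injective linear map on 3 |V| unknowns. Its
    values are one equation for each of the |F| - 3 members of [F] off the triangle and 3 (|V| - |U|
    + 3) pinned coordinates; the 6 is 9 - 3. *)
Lemma grigid_card U E (F : {set {set V}}) :
  (forall u v, u \in U -> v \in U -> E u v -> [set u; v] \in F) ->
  grigid U E -> (3 * #|U| <= #|F| + 6)%N.
Proof.
move=> sF [[a [b [c /and3P[/and3P[ab bc ac] hU hE]]]] [p [/gen_posP gp r]]].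
have /(pinned_inj _ _ hU) inj := rigid_pinned (gp a b c ab bc ac) hU r.
pose S := [set [set a; b]; [set b; c]; [set a; c]].
(* The orientation chosen for an edge only affects the sign of its equation. A member of [F] that is
   not a pair gets [(a, a)], whose equation is void. *)
pose ends (e : {set V}) := odflt (a, a) [pick w : V * V | e == [set w.1; w.2]].
have endsP u v : [set (ends [set u; v]).1; (ends [set u; v]).2] = [set u; v].
  rewrite /ends; case: pickP => [w /eqP<-|/(_ (u, v))] //=.
  by rewrite eqxx.
have eq2 (u v x y : V) : [set u; v] = [set x; y] ->
    (u = x /\ v = y) \/ (u = y /\ v = x).
  move=> e.
  have: (u \in [set x; y]) && (v \in [set x; y]) by rewrite -e !inE !eqxx orbT.
  have: (x \in [set u; v]) && (y \in [set u; v]) by rewrite e !inE !eqxx orbT.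
  rewrite !inE => /andP[/orP[]/eqP hx /orP[]/eqP hy] /andP[/orP[]/eqP hu /orP[]/eqP hv];
  by subst; auto.
have cS : #|S| = 3%N.
  have nin (x u v : V) (e : {set V}) : x \in e -> x != u -> x != v -> e != [set u; v].
    move=> xe xu xv; apply: contraTneq xe => ->.
    by rewrite !inE (negbTE xu) (negbTE xv).
  rewrite /S setUC cardsU1 cards2 !inE negb_or.
  rewrite (nin c a b) ?set22 1?eq_sym // (nin a b c) ?set21 //.
  by rewrite (nin b a c) ?set21 // eq_sym.
have sSF : S \subset F.
  move: hU hE => /and3P[aU bU cU] /and3P[Eab Ebc Eac].
  by apply/subsetP => e; rewrite !inE => /orP[/orP[]|]/eqP->; apply: sF.
pose F' := F :\: S; pose W := ~: (U :\: [set a; b; c]).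
pose L (m : {ffun V -> 'rV[rat]_3}) :
    {ffun {e | e \in F'} -> rat^o} * {ffun {v | v \in W} -> 'rV[rat]_3} :=
  ([ffun e => dot (m (ends (val e)).1) (p (ends (val e)).2)
            - dot (m (ends (val e)).2) (p (ends (val e)).1)],
   [ffun v => m (val v)]).
have Llin : linear L.
  move=> k m m'; congr pair; apply/ffunP => w; rewrite !ffunE //.
  by rewrite !dotDl !dotZl /GRing.scale /= mulrBr opprD addrACA.
pose Lm := GRing.isLinear.Build rat _ _ _ L Llin.
pose LL : {linear _ -> _} := HB.pack L Lm.
have Linj m : LL m = 0 -> m = 0.
  rewrite /LL /= {LL Lm Llin} => h; apply: inj; move: h => [e1 e2].
  have mW v : v \in W -> m v = 0.
    by move=> hv; move/ffunP/(_ (exist _ v hv)): e2; rewrite !ffunE.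
  have m3 v : v \in [set a; b; c] -> m v = 0.
    by move=> hv; apply: mW; rewrite !inE in hv *; rewrite hv.
  congr pair; apply/ffunP => w; rewrite !ffunE; last first.
    case: ifP => // /negbT hw. by apply: mW; rewrite inE.
  case: w => u v /=; case: ifP => // /and3P[uU vU uv].
  case: (boolP ([set u; v] \in S)) => [|nS].
    have hz u' v' : u' \in [set a; b; c] -> v' \in [set a; b; c] ->
      [set u; v] = [set u'; v'] -> dot (m u) (p v) - dot (m v) (p u) = 0.
      move=> hu hv /eq2[[-> ->]|[-> ->]]; by rewrite !m3 // /dot !mul0mx !mxE subrr.
    rewrite !inE => /orP[/orP[]|]/eqP; apply: hz; by rewrite !inE eqxx ?orbT.
  have eF : [set u; v] \in F' by rewrite inE nS sF.
  move/ffunP/(_ (exist (fun e => e \in F') _ eF)): e1; rewrite !ffunE /=.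
  case: (eq2 _ _ _ _ (endsP u v)) => -[-> ->] //.
  by move=> h; apply/eqP; rewrite -oppr_eq0 opprB; apply/eqP.
have := linear_inj_dim Linj; rewrite /dim /= {LL Lm Llin Linj}.
rewrite /dim /= /dim /= !card_sig.
have -> : #|[pred x in F']| = (#|F| - 3)%N.
  by rewrite -cS -cardsDS //; apply: eq_card => x; rewrite inE.
have -> : #|[pred x in W]| = (#|V| - (#|U| - 3))%N.
  have cabc : #|[set a; b; c]| = 3%N.
    by rewrite setUC cardsU1 cards2 !inE negb_or ab eq_sym ac eq_sym bc.
  rewrite -[3%N in RHS]cabc -cardsDS; last first.
    move/and3P: hU => [aU bU cU].
    by apply/subsetP => x; rewrite !inE => /orP[/orP[]|]/eqP->.
  rewrite (cardsCs (U :\: _)) subKn ?max_card //; apply: eq_card => x; rewrite inE.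
have leU := max_card U.
have hF : (3 <= #|F|)%N by rewrite -cS subset_leq_card.
move: leU hF; move: (#|_|) (#|U|) (#|F|) => nV nU nF; lia.
Qed.

End Rigidity.

(** * Minimal cycles modulo 2 are rigid *)

Section MinimalCycles.
Variable V : finType.
Implicit Types (C P Q D : {set {set V}}) (t : {set V}) (u v x y z : V).

Definition codeg C x y := #|[set t in C | (x \in t) && (y \in t)]|.

Definition triple_family C := [forall t in C, #|t| == 3].

Definition mod2_cycle C := triple_family C &&
  [forall x, forall y, (x != y) ==> ~~ odd (codeg C x y)].

(** Stated for any [p] because it serves both cycles and the relative cycles that describe a
    contraction. *)
Definition minimal_in (p : pred {set {set V}}) C :=
  [/\ p C, C != set0 & forall P, P \subset C -> P != set0 -> p P -> P = C].

Definition graph_of C : rel V :=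
  fun x y => (x != y) && [exists t in C, (x \in t) && (y \in t)].

Lemma graph_ofP C x y :
  reflect (x != y /\ exists2 t, t \in C & (x \in t) && (y \in t)) (graph_of C x y).
Proof. by apply: (iffP andP) => -[h1] => [/exists_inP|/exists_inP] h2. Qed.

Lemma codegC C x y : codeg C x y = codeg C y x.
Proof. by apply: eq_card => t; rewrite !inE [(x \in t) && _]andbC. Qed.

Lemma codegD C P x y : P \subset C ->
  codeg C x y = codeg P x y + codeg (C :\: P) x y.
Proof.
move=> sPC; rewrite /codeg -cardsUI.
rewrite [X in _ + X](_ : _ = 0) ?addn0; last first.
  apply/eqP; rewrite cards_eq0; apply/eqP.
  by apply/setP => t; rewrite !inE; case: (t \in P); rewrite /= ?andbF.
apply: eq_card => t; rewrite !inE.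
by have := subsetP sPC t; case: (t \in P) => [->//|_]; rewrite /= ?orbF.
Qed.

Lemma codeg_gt0 C x y : x != y -> 0 < codeg C x y -> graph_of C x y.
Proof.
move=> xy /card_gt0P[t]; rewrite inE => /andP[tC ht].
by apply/graph_ofP; split=> //; exists t.
Qed.

Lemma graph_of_mono C P x y : P \subset C -> graph_of P x y -> graph_of C x y.
Proof.
move=> /subsetP s /graph_ofP[xy [t tP h]]; apply/graph_ofP; split=> //.
by exists t => //; apply: s.
Qed.

(** Each triple through [u] has two further vertices, so the codegrees at [u] have an even sum and a
    single one of them cannot be odd. *)
Lemma codeg_handshake C u x0 : triple_family C -> u != x0 ->
  (forall x, x != u -> x != x0 -> ~~ odd (codeg C u x)) -> ~~ odd (codeg C u x0).
Proof.
move=> /forall_inP C3 ux0 hx.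
have : ~~ odd (\sum_(x | x != u) codeg C u x).
  have -> : \sum_(x | x != u) codeg C u x =
            \sum_(t in C | u \in t) \sum_(x | x != u) (x \in t).
    rewrite exchange_big /=; apply: eq_bigr => x _.
    rewrite /codeg -sum1_card big_mkcond [RHS]big_mkcond /=.
    apply: eq_bigr => t _; rewrite !inE.
    by case: (t \in C); case: (u \in t); case: (x \in t).
  rewrite (eq_bigr (fun=> 2)); first by rewrite sum_nat_const oddM andbF.
  move=> t /andP[/C3/eqP c3 ut].
  have := cardsD1 u t; rewrite ut c3 => -[e].
  rewrite -big_mkcondr sum1_card [RHS]e; apply: eq_card => x.
  by rewrite !inE.
rewrite (bigD1 x0) 1?eq_sym //= oddD.
have -> : odd (\sum_(x | (x != u) && (x != x0)) codeg C u x) = false.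
  apply: (big_ind (fun n => odd n = false)) => // [m n em en|x /andP[]].
    by rewrite oddD em en.
  by move=> xu xx0; apply/negbTE/hx.
by rewrite addbF.
Qed.

Lemma mod2_cycleD C P : mod2_cycle C -> mod2_cycle P -> P \subset C ->
  mod2_cycle (C :\: P).
Proof.
move=> /andP[/forall_inP C3 /forallP hC] /andP[_ /forallP hP] sPC; apply/andP; split.
  by apply/forall_inP => t; rewrite inE => /andP[_]; apply: C3.
apply/forallP => x; apply/forallP => y; apply/implyP => xy.
have /forallP/(_ y)/implyP/(_ xy) := hC x; have /forallP/(_ y)/implyP/(_ xy) := hP x.
by rewrite (codegD x y sPC) oddD => /negbTE->.
Qed.

(** [P] is chosen minimal among the members containing [t]. A smaller [Q] missing [t] cannot occur,
    because its complement in [P] would be a smaller member containing [t]. *)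
Lemma minimal_in_exists (p : pred {set {set V}}) C t :
  (forall C P, p C -> p P -> P \subset C -> p (C :\: P)) ->
  p C -> t \in C -> exists P, [/\ minimal_in p P, t \in P & P \subset C].
Proof.
move=> pD pC tC; have [|P /minsetP[/andP[pP tP] minP] sPC] :=
  @minset_exists _ [pred P | p P && (t \in P)] C; first by rewrite /= pC.
exists P; split=> //; split=> //; first by apply/set0Pn; exists t.
move=> Q sQP Q0 pQ; have [tQ|ntQ] := boolP (t \in Q).
  by apply: minP => //=; rewrite pQ.
have e : P :\: Q = P by apply: minP; rewrite /= ?subsetDl // pD // inE ntQ.
by case/set0Pn: Q0 => s sQ; have := subsetP sQP s sQ; rewrite -e inE sQ.
Qed.

Lemma card3_set t : #|t| = 3 ->
  exists x y z, t = [set x; y; z] /\ [&& x != y, y != z & x != z].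
Proof.
move=> c3.
have /card_gt0P[x xt] : 0 < #|t| by rewrite c3.
have := cardsD1 x t; rewrite xt c3 => -[/esym c2].
have /cards2P[y [z [yz e]]] : #|t :\ x| == 2 by apply/eqP.
have xyz w : w \in [set y; z] -> x != w by rewrite -e !inE => /andP[]; rewrite eq_sym.
exists x, y, z; split.
  by rewrite -setUA -e setD1K.
by rewrite yz !xyz ?set21 ?set22.
Qed.

(** * Contracting an edge of a cycle *)

Section Contraction.
Variables (u v : V).
Hypothesis uv : u != v.

Notation gam := (contract u v).

(** The condition that contracting [v] to [u] yields a cycle modulo 2, images being counted with
    multiplicity. It is read off before the contraction, so that the pieces of the contracted cycle
    remain subfamilies of the original one. *)
Definition rel_cycle P :=
  [&& [forall x, forall y, [&& x != y, x != u, x != v, y != u & y != v] ==>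
         ~~ odd (codeg P x y)],
      [forall x, (x != u) && (x != v) ==> ~~ odd (codeg P u x + codeg P v x)]
    & [forall t in P, (#|t| == 3) && ~~ ((u \in t) && (v \in t))]].

Lemma rel_cycleP P : reflect
  [/\ forall x y, x != y -> x != u -> x != v -> y != u -> y != v -> ~~ odd (codeg P x y),
      forall x, x != u -> x != v -> ~~ odd (codeg P u x + codeg P v x),
      forall t, t \in P -> #|t| = 3
    & forall t, t \in P -> u \in t -> v \notin t] (rel_cycle P).
Proof.
apply: (iffP and3P) => -[h1 h2 h3]; last first.
  move=> h4; split.
  - apply/forallP => x; apply/forallP => y; apply/implyP => /and5P[*]; exact: h1.
  - by apply/forallP => x; apply/implyP => /andP[*]; apply: h2.
  - apply/forall_inP => t tP; rewrite h3 //=.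
    by have := h4 t tP; case: (u \in t) => // ->.
split.
- by move=> x y xy xu xv yu yv; have := forallP (forallP h1 x) y; rewrite xy xu xv yu yv.
- by move=> x xu xv; have := forallP h2 x; rewrite xu xv.
- by move=> t /(forall_inP h3)/andP[/eqP].
- by move=> t /(forall_inP h3)/andP[_]; rewrite negb_and => /orP[/negP|].
Qed.

Lemma rel_cycleD C P : rel_cycle C -> rel_cycle P -> P \subset C ->
  rel_cycle (C :\: P).
Proof.
move=> /rel_cycleP[c1 c2 c3 c4] /rel_cycleP[p1 p2 p3 p4] s; apply/rel_cycleP; split.
- move=> x y xy xu xv yu yv; have := c1 x y xy xu xv yu yv.
  by rewrite (codegD x y s) oddD (negbTE (p1 x y xy xu xv yu yv)).
- move=> x xu xv; have := c2 x xu xv; rewrite !(codegD _ x s) addnACA oddD.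
  by rewrite (negbTE (p2 x xu xv)).
- by move=> t /setDP[/c3].
- by move=> t /setDP[/c4].
Qed.

Definition off_edge C := [set t in C | ~~ ((u \in t) && (v \in t))].

(** A discarded triple [u v x] counts once at [u x] and once at [v x], so the parity of the sum is
    unaffected; and it contains no pair avoiding both [u] and [v]. *)
Lemma off_edge_rel_cycle C : mod2_cycle C -> rel_cycle (off_edge C).
Proof.
move=> /andP[/forall_inP C3 /forallP hC].
have {hC}hC x y : x != y -> ~~ odd (codeg C x y).
  by move=> xy; have := forallP (hC x) y; rewrite xy.
have s : off_edge C \subset C by apply/subsetP => t; rewrite inE => /andP[].
apply/rel_cycleP; split.
- move=> x y xy xu xv yu yv; have := hC x y xy; rewrite (codegD x y s).
  rewrite [X in _ + X](_ : _ = 0) ?addn0 //; apply/eqP; rewrite cards_eq0.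
  apply/eqP/setP => t; rewrite !inE -andbA; apply/negbTE/negP.
  move=> /and4P[h tC xt yt]; move: h; rewrite tC negbK => /andP[ut vt].
  have un : uniq [:: x; y; u; v].
    by rewrite /= !inE uv (negbTE xy) (negbTE xu) (negbTE xv) (negbTE yu) (negbTE yv).
  have := uniq_leq_size (s2 := enum t) un; rewrite -cardE (eqP (C3 t tC)) /=.
  have sub : {subset [:: x; y; u; v] <= enum t}.
    by move=> w; rewrite mem_enum !inE => /or4P[]/eqP->.
  by move/(_ sub).
- move=> x xu xv; have := hC u x; have := hC v x; rewrite ![_ == x]eq_sym xu xv.
  rewrite !(codegD _ x s) !oddD => /(_ isT) hv /(_ isT) hu.
  have e : codeg (C :\: off_edge C) u x = codeg (C :\: off_edge C) v x.
    apply: eq_card => t; rewrite !inE.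
    by case: (t \in C); case: (u \in t); case: (v \in t).
  by move: hu hv; rewrite e; do 3 case: odd.
- by move=> t; rewrite inE => /andP[/C3/eqP].
- by move=> t; rewrite inE negb_and => /andP[_ /orP[/negP|]].
Qed.

Lemma in_contract t x : (x \in gam @: t) =
  if x == u then (u \in t) || (v \in t) else (x != v) && (x \in t).
Proof.
have cu : gam u = u by rewrite /contract (negbTE uv).
have cv : gam v = u by rewrite /contract eqxx.
apply/imsetP/idP => [[y yt ->]|].
  rewrite {1 2 3}/contract; case: (eqVneq y v) => [ey|nyv]; rewrite ?eqxx.
    by rewrite -ey yt orbT.
  case: eqVneq => [ey|//]; first by rewrite -ey yt.
  by rewrite nyv.
case: eqVneq => [->|xu /andP[xv xt]].
  by case/orP=> h; [exists u | exists v].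
by exists x; rewrite // /contract (negbTE xv).
Qed.

Lemma contract_inj t : ~~ ((u \in t) && (v \in t)) -> {in t &, injective gam}.
Proof.
move=> h x y xt yt; rewrite /contract.
have [xv|nxv] := eqVneq x v; have [yv|nyv] := eqVneq y v; rewrite ?xv ?yv //.
- by move=> e; move: h; rewrite e yt -xv xt.
- by move=> e; move: h; rewrite -e xt -yv yt.
Qed.

Notation cfam P := [set gam @: (t : {set V}) | t in P].

Section Family.
Variable P : {set {set V}}.
Hypothesis P4 : forall t, t \in P -> u \in t -> v \notin t.
Hypothesis Pinj : {in P &, injective (fun t : {set V} => gam @: t)}.

Lemma codeg_cfam_off x y : x != u -> x != v -> y != u -> y != v ->
  codeg (cfam P) x y = codeg P x y.
Proof.
move=> xu xv yu yv; rewrite /codeg -[RHS](card_in_imset (f := fun t : {set V} => gam @: t)).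
  apply: eq_card => s; rewrite !inE; apply/andP/imsetP.
    move=> [/imsetP[t tP ->]]; rewrite !in_contract (negbTE xu) (negbTE yu) xv yv /=.
    by move=> h; exists t; rewrite // inE tP.
  move=> [t]; rewrite inE => /andP[tP h ->]; split; first exact: imset_f.
  by rewrite !in_contract (negbTE xu) (negbTE yu) xv yv.
by move=> s t; rewrite !inE => /andP[sP _] /andP[tP _]; apply: Pinj.
Qed.

Lemma codeg_cfam_end y : y != u -> y != v ->
  codeg (cfam P) u y = codeg P u y + codeg P v y.
Proof.
move=> yu yv; rewrite /codeg -cardsUI [X in _ + X](_ : _ = 0) ?addn0; last first.
  apply/eqP; rewrite cards_eq0; apply/eqP/setP => t; rewrite !inE.
  apply/negbTE/negP => /andP[/and3P[tP ut _] /and3P[_ vt _]].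
  by have := P4 tP ut; rewrite vt.
rewrite -[RHS](card_in_imset (f := fun t : {set V} => gam @: t)).
  apply: eq_card => s; rewrite !inE; apply/andP/imsetP.
    move=> [/imsetP[t tP ->]]; rewrite !in_contract (negbTE yu) yv eqxx /=.
    by move=> h; exists t; rewrite // !inE tP /= -andb_orl.
  move=> [t]; rewrite !inE -andb_orr => /andP[tP h ->]; split; first exact: imset_f.
  by rewrite !in_contract (negbTE yu) yv eqxx /= andb_orl.
move=> s t; rewrite !inE -!andb_orr => /andP[sP _] /andP[tP _]; exact: Pinj.
Qed.

Lemma codeg_cfam0 y : codeg (cfam P) v y = 0.
Proof.
apply/eqP; rewrite cards_eq0; apply/eqP/setP => s; rewrite !inE.
apply/negbTE/negP => /and3P[/imsetP[t _ ->]]; rewrite in_contract.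
by rewrite eq_sym (negbTE uv) eqxx.
Qed.

Hypothesis P3 : forall t, t \in P -> #|t| = 3.

Lemma rel_cycle_cfam : rel_cycle P = mod2_cycle (cfam P).
Proof.
apply/rel_cycleP/andP => [[h1 h2 _ _]|[_ /forallP h]].
  split.
    apply/forall_inP => s /imsetP[t tP ->]; rewrite card_in_imset ?P3 //.
    by apply: contract_inj; have := P4 tP; case: (u \in t) => // ->.
  apply/forallP => x; apply/forallP => y; apply/implyP => xy.
  have [->|xv] := eqVneq x v; first by rewrite codeg_cfam0.
  have [->|yv] := eqVneq y v; first by rewrite codegC codeg_cfam0.
  have [exu|xu] := eqVneq x u.
    by rewrite exu codeg_cfam_end ?h2 // -exu eq_sym.
  have [eyu|yu] := eqVneq y u.
    by rewrite eyu codegC codeg_cfam_end ?h2.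
  by rewrite codeg_cfam_off ?h1.
have {}h x y : x != y -> ~~ odd (codeg (cfam P) x y).
  by move=> xy; have := forallP (h x) y; rewrite xy.
split=> //.
- by move=> x y xy xu xv yu yv; rewrite -codeg_cfam_off ?h.
- by move=> x xu xv; rewrite -codeg_cfam_end // h // eq_sym.
Qed.

End Family.


Lemma mem_coverP P x : reflect (exists2 t, t \in P & x \in t) (x \in cover P).
Proof. exact: bigcupP. Qed.

(* Two triples [uyz] and [vyz] that become equal cancel modulo 2, so together
   they already form a relative cycle. *)
Lemma twins_rel_cycle (t s : {set V}) : #|t| = 3 -> #|s| = 3 -> t != s ->
  ~~ ((u \in t) && (v \in t)) -> ~~ ((u \in s) && (v \in s)) ->
  gam @: t = gam @: s -> rel_cycle [set t; s].
Proof.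
move=> t3 s3 ts nt ns e.
have off x : x != u -> x != v -> (x \in t) = (x \in s).
  by move=> xu xv; move/setP/(_ x): e; rewrite !in_contract (negbTE xu) xv.
have eu : (u \in t) || (v \in t) = (u \in s) || (v \in s).
  by move/setP/(_ u): e; rewrite !in_contract eqxx.
have eus : (u \in t) = (v \in s).
  apply/eqP; apply: contraNT ts => ne; apply/eqP/setP => x.
  have [->|xu] := eqVneq x u; last have [->|xv] := eqVneq x v; last exact: off.
    by move: nt ns eu ne; do 4 case: (_ \in _).
  by move: nt ns eu ne; do 4 case: (_ \in _).
have evs : (v \in t) = (u \in s).
  by move: nt ns eu eus; do 4 case: (_ \in _).
have cd x y : codeg [set t; s] x y =
    ((x \in t) && (y \in t)) + ((x \in s) && (y \in s)).
  rewrite /codeg -sum1_card big_mkcond /= (bigD1 t) //= (bigD1 s) /=; last first.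
    by rewrite eq_sym.
  rewrite big1 => [|r /andP[rt rs]].
    by rewrite !inE !eqxx orbT addn0; do 4 case: (_ \in _).
  by rewrite !inE (negbTE rt) (negbTE rs).
apply/rel_cycleP; split.
- by move=> x y _ xu xv yu yv; rewrite cd !off // addnn odd_double.
- move=> x xu xv; rewrite !cd (off x) // eus evs.
  by do 3 case: (_ \in _).
- by move=> r /set2P[] ->.
- by move=> r /set2P[] -> h; [move: nt | move: ns]; rewrite h.
Qed.

Section Piece.
Variable C : {set {set V}}.
Hypothesis Cmin : minimal_in mod2_cycle C.
Hypothesis Cuv : graph_of C u v.
Hypothesis IH : forall D, minimal_in mod2_cycle D -> #|cover D| < #|cover C| ->
  grigid (cover D) (graph_of D).

(** If no third vertex had odd codegree with [u] in [P], then [P] would be a cycle modulo 2, hence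
    all of [C], yet some triple of [C] contains both [u] and [v]. By the handshake there are two
    such vertices, and a relative cycle has the same parity at [v] as at [u]. *)
Lemma piece_common_neighbours P : P \subset off_edge C -> P != set0 -> rel_cycle P ->
  exists a b, [&& a != u, a != v, b != u, b != v & a != b] /\
    [&& a \in cover P, b \in cover P, graph_of P u a, graph_of P v a,
        graph_of P u b & graph_of P v b].
Proof.
move=> sP P0 rP; case: (Cmin) => cC C0 minC.
have /rel_cycleP[r1 r2 r3 r4] := rP.
have P3 : triple_family P by apply/forall_inP => t /r3->.
have uv0 : codeg P u v = 0.
  apply/eqP; rewrite cards_eq0; apply/eqP/setP => t; rewrite !inE.
  by apply/negbTE/negP => /and3P[tP ut vt]; have := r4 t tP ut; rewrite vt.
have good a : a != u -> a != v -> odd (codeg P u a) ->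
    [&& a \in cover P, graph_of P u a & graph_of P v a].
  move=> au av oa.
  have ga : graph_of P u a by apply: codeg_gt0; rewrite 1?eq_sym //; case: codeg oa.
  apply/and3P; split=> //.
    by have /graph_ofP[_ [t tP /andP[_ at_]]] := ga; apply/mem_coverP; exists t.
  apply: codeg_gt0; rewrite 1?eq_sym //.
  by have := r2 a au av; rewrite oddD oa; case: codeg.
have [a /and3P[au av oa]] : exists a, [&& a != u, a != v & odd (codeg P u a)].
  apply/existsP; apply: contraT => /existsPn h.
  have {}h x : x != u -> x != v -> ~~ odd (codeg P u x).
    by move=> xu xv; have := h x; rewrite xu xv.
  have hv x : x != u -> x != v -> ~~ odd (codeg P v x).
    by move=> xu xv; have := r2 x xu xv; rewrite oddD (negbTE (h x xu xv)).
  have cP : mod2_cycle P.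
    rewrite /mod2_cycle P3; apply/forallP => x; apply/forallP => y; apply/implyP => xy.
    have [exu|xu] := eqVneq x u; last have [exv|xv] := eqVneq x v.
    - have [->|yv] := eqVneq y v; first by rewrite exu uv0.
      by rewrite exu h // -exu eq_sym.
    - have [->|yu] := eqVneq y u; first by rewrite exv codegC uv0.
      by rewrite exv hv // -exv eq_sym.
    - have [->|yu] := eqVneq y u; first by rewrite codegC h.
      have [->|yv] := eqVneq y v; first by rewrite codegC hv.
      exact: r1.
  have eP : P = C.
    apply: minC => //; apply: subset_trans sP _.
    by apply/subsetP => t; rewrite inE => /andP[].
  have /graph_ofP[_ [t tC huv]] := Cuv.
  by have := subsetP sP t; rewrite eP => /(_ tC); rewrite inE huv andbF.
have [b /and3P[bu ba ob]] : exists b, [&& b != u, b != a & odd (codeg P u b)].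
  apply/existsP; apply: contraTT oa => /existsPn h.
  apply: codeg_handshake => //; first by rewrite eq_sym.
  by move=> x xu xa; have := h x; rewrite xu xa.
have bv : b != v by apply: contraTneq ob => ->; rewrite uv0.
exists a, b; rewrite au av bu bv eq_sym ba; split=> //.
have /and3P[-> -> ->] := good a au av oa.
by have /and3P[-> -> ->] := good b bu bv ob.
Qed.

(** By minimality of [P], its contraction is a single triangle or a minimal cycle with fewer
    vertices than [C]. Either is rigid, and splitting [u] back into [u] and [v] keeps it so. The
    graph is that of [C] because no triple of [P] contains the edge [u v]. *)
Lemma piece_grigid P : P \subset off_edge C -> minimal_in rel_cycle P ->
  grigid (cover P :|: [set u; v]) (graph_of C).
Proof.
move=> sP [rP P0 minP].
have [a [b [nab /and5P[aP bP gua gva /andP[gub gvb]]]]] := piece_common_neighbours sP P0 rP.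
have sPC : P \subset C.
  by apply: subset_trans sP _; apply/subsetP => t; rewrite inE => /andP[].
have /rel_cycleP[r1 r2 r3 r4] := rP.
have nuv t : t \in P -> ~~ ((u \in t) && (v \in t)).
  by move=> /r4; case: (u \in t) => // ->.
have [t0 t0P] : exists t, t \in P by apply/set0Pn.
have [x [y [z [et0 /and3P[xy yz xz]]]]] := card3_set (r3 t0 t0P).
have gt0 w w' : w \in t0 -> w' \in t0 -> w != w' -> graph_of C w w'.
  move=> wt w't ww'; apply/graph_ofP; split=> //; exists t0; first exact: (subsetP sPC).
  by rewrite wt w't.
have xt0 : x \in t0 by rewrite et0 !inE eqxx.
have yt0 : y \in t0 by rewrite et0 !inE eqxx !orbT.
have zt0 : z \in t0 by rewrite et0 !inE eqxx !orbT.
have incov w : w \in t0 -> w \in cover P by move=> ?; apply/mem_coverP; exists t0.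
have inj0 := contract_inj (nuv t0 t0P).
have split_from (E' : rel V) :
    (forall x y, E' x y -> exists x' y', [/\ x' \in cover P, y' \in cover P,
       contract u v x' = x, contract u v y' = y & graph_of C x' y']) ->
    grigid ((cover P :|: [set u; v]) :\ v) E' ->
    grigid (cover P :|: [set u; v]) (graph_of C).
  move=> hE'; apply: (@grigid_split _ _ _ _ u v a b x y z) => //.
  - by rewrite !inE !eqxx aP bP !orbT.
  - by rewrite Cuv !(graph_of_mono sPC).
  - apply/and3P; split; first by rewrite xy yz xz.
      by rewrite !inE !incov.
    by rewrite !gt0.
  - by rewrite !(inj_in_eq inj0) // xy yz xz.
  move=> p q _ _ /hE'[p' [q' [hp hq e1 e2 e3]]]; exists p', q'.
  by rewrite !inE hp hq.
have Uv : (cover P :|: [set u; v]) :\ v = cover (cfam P).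
  apply/setP => w; rewrite !inE; apply/andP/mem_coverP.
    move=> [wv /orP[/mem_coverP[t tP wt]|]].
      exists (gam @: t); first exact: imset_f.
      by rewrite in_contract; case: eqVneq => [<-|]; rewrite ?wt ?wv.
    rewrite (negbTE wv) orbF => /eqP->.
    have /graph_ofP[_ [t tP /andP[ut _]]] := gua.
    exists (gam @: t); first exact: imset_f.
    by rewrite in_contract eqxx ut.
  move=> [s /imsetP[t tP ->]]; rewrite in_contract.
  case: eqVneq => [->|wu /andP[wv wt]]; first by rewrite uv orbT.
  by split=> //; apply/orP; left; apply/mem_coverP; exists t.
have lift p q : graph_of (cfam P) p q -> exists x' y', [/\ x' \in cover P,
    y' \in cover P, contract u v x' = p, contract u v y' = q & graph_of C x' y'].
  move=> /graph_ofP[pq [s /imsetP[t tP ->] /andP[/imsetP[p' p't ep] /imsetP[q' q't eqq]]]].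
  exists p', q'; split=> //; try by apply/mem_coverP; exists t.
  apply/graph_ofP; split; first by apply: contraNneq pq => e; rewrite ep eqq e.
  by exists t; rewrite ?p't //; apply: (subsetP sPC).
apply: (split_from _ lift); rewrite Uv.
have [/existsP[t /existsP[s /and4P[tP sPP nts /eqP ets]]]|noinj] :=
  boolP [exists t, exists s, [&& t \in P, s \in P, t != s & gam @: t == gam @: s]].
  have eP : [set t; s] = P.
    apply: minP; last by apply: twins_rel_cycle; rewrite ?r3 ?nuv.
      by apply/subsetP => r /set2P[] ->.
    by apply/set0Pn; exists t; rewrite set21.
  have ec : cfam P = [set gam @: t].
    rewrite -eP; apply/setP => r; rewrite inE; apply/imsetP/eqP => [[q /set2P[]-> ->//]|->].
    by exists t; rewrite ?set21.
  have eg : gam @: t0 = gam @: t.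
    by move: t0P; rewrite -eP => /set2P[]->.
  rewrite ec; have -> : cover [set gam @: t] = [set gam x; gam y; gam z].
    by rewrite /cover big_set1 -eg et0 !imsetU !imset_set1.
  apply: grigid_triangle; apply/and3P; split.
  - by rewrite !(inj_in_eq inj0) // xy yz xz.
  - by rewrite !inE !eqxx !orbT.
  - apply/and3P; split; apply/graph_ofP; rewrite (inj_in_eq inj0) //; split=> //;
    by exists (gam @: t); rewrite ?set11 // -eg !imset_f.
have Pinj : {in P &, injective (fun t : {set V} => gam @: t)}.
  move=> t s tP sPP ets; apply: contraNeq noinj => nts.
  by apply/existsP; exists t; apply/existsP; exists s; rewrite tP sPP nts; apply/eqP.
apply: IH; last first.
  apply: proper_card; apply/properP; split.
    rewrite -Uv; apply/subsetP => w; rewrite !inE => /andP[_ /orP[|]].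
      by move=> /mem_coverP[t tP wt]; apply/mem_coverP; exists t => //; apply: (subsetP sPC).
    have /graph_ofP[_ [t tC /andP[ut vt]]] := Cuv.
    by move=> /orP[]/eqP->; apply/mem_coverP; exists t.
  exists v; last by rewrite -Uv !inE eqxx.
  have /graph_ofP[_ [t tC /andP[ut vt]]] := Cuv.
  by apply/mem_coverP; exists t.
split.
- by rewrite -rel_cycle_cfam.
- by apply/set0Pn; exists (gam @: t0); apply: imset_f.
move=> D sD D0 cD.
(* A subcycle of the contraction pulls back to a relative cycle inside [P], and minimality leaves
   only [P] itself. *)
pose P' := [set t in P | gam @: t \in D].
have sP' : P' \subset P by apply/subsetP => t; rewrite inE => /andP[].
have eD : cfam P' = D.
  apply/setP => s; apply/imsetP/idP => [[t]|sD'].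
    by rewrite inE => /andP[_ ? ->].
  have /imsetP[t tP es] := subsetP sD s sD'.
  by exists t => //; rewrite inE tP -es.
rewrite -eD; suff -> : P' = P by [].
apply: minP => //.
  case/set0Pn: D0 => s; rewrite -eD => /imsetP[t tP' _].
  by apply/set0Pn; exists t.
rewrite rel_cycle_cfam ?eD //.
- by move=> t /(subsetP sP'); apply: r4.
- by move=> t s /(subsetP sP') tP /(subsetP sP') ; apply: Pinj.
- by move=> t /(subsetP sP'); apply: r3.
Qed.

(** [Q] collects the pieces glued so far. While it shares a third vertex [x] with the remaining
    triples, a piece through [x] is glued along [u], [v], [x]. Otherwise [Q] together with the
    triples [u v y] for [y] in [cover Q] is a cycle modulo 2, which by minimality is [C]. *)
Lemma pieces_grigid k Q : #|off_edge C :\: Q| < k -> Q \subset off_edge C ->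
  Q != set0 -> rel_cycle Q -> grigid (cover Q :|: [set u; v]) (graph_of C) ->
  grigid (cover C) (graph_of C).
Proof.
case: (Cmin) => cC C0 minC.
have rC := off_edge_rel_cycle cC.
have sC : off_edge C \subset C by apply/subsetP => t; rewrite inE => /andP[].
elim: k Q => [//|k ihk] Q hk sQ Q0 rQ gQ.
pose R := off_edge C :\: Q.
have rR : rel_cycle R by apply: rel_cycleD.
have [/existsP[x /and4P[xu xv xQ /mem_coverP[t tR xt]]]|sep] :=
  boolP [exists x, [&& x != u, x != v, x \in cover Q & x \in cover R]].
  have [P [minP tP sPR]] := minimal_in_exists rel_cycleD rR tR.
  have sP : P \subset off_edge C by apply: subset_trans sPR (subsetDl _ _).
  have gP := piece_grigid sP minP.
  have rQP : rel_cycle (Q :|: P).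
    have -> : Q :|: P = off_edge C :\: (R :\: P).
      apply/setP => s; have := subsetP sPR s; have := subsetP sQ s.
      rewrite in_setU !in_setD; case: (s \in off_edge C); last first.
        by case: (s \in Q) => [/(_ isT)|]; case: (s \in P) => // _ /(_ isT); rewrite andbF.
      by case: (s \in Q); case: (s \in P) => // _ /(_ isT).
    apply: rel_cycleD => //; last by apply: subset_trans (subsetDl _ _) (subsetDl _ _).
    by apply: rel_cycleD => //; case: minP.
  apply: (ihk (Q :|: P)) => //.
  - rewrite -ltnS; apply: leq_trans hk; rewrite ltnS; apply: proper_card.
    apply/properP; split; first by apply: setDS; apply: subsetUl.
    exists t => //; by rewrite !inE tP orbT.
  - by rewrite subUset sQ sP.
  - by case/set0Pn: Q0 => s sQ'; apply/set0Pn; exists s; rewrite inE sQ'.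
  have -> : cover (Q :|: P) :|: [set u; v] =
      (cover Q :|: [set u; v]) :|: (cover P :|: [set u; v]).
    by rewrite /cover bigcup_setU setUUl.
  have xP : x \in cover P by apply/mem_coverP; exists t.
  apply: (@grigid_glue _ _ _ _ u v x) => //.
  - by rewrite uv ![_ == x]eq_sym xu xv.
  - by rewrite !inE !eqxx xQ !orbT.
  - by rewrite !inE !eqxx xP !orbT.
have {}sep x : x != u -> x != v -> x \in cover Q -> x \notin cover R.
  move=> xu xv xQ; apply: contraNN sep => xR; apply/existsP; exists x.
  by rewrite xu xv xQ xR.
pose Q' := Q :|: [set t in C | [&& u \in t, v \in t & [exists x, [&& x != u, x != v, x \in t & x \in cover Q]]]].
have sQ' : Q' \subset C.
  rewrite subUset (subset_trans sQ sC); by apply/subsetP => t; rewrite inE => /andP[].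
have Q'3 : triple_family Q'.
  have /andP[/forall_inP C3 _] := cC.
  by apply/forall_inP => t /(subsetP sQ'); apply: C3.
have hC x y : x != y -> ~~ odd (codeg C x y).
  by have /andP[_ /forallP h] := cC => xy; have := forallP (h x) y; rewrite xy.
have third t x : t \in C -> u \in t -> v \in t -> x \in t -> x != u -> x != v ->
    forall y, y \in t -> y != u -> y != v -> y = x.
  move=> tC ut vt xt xu xv y yt yu yv; apply/eqP; apply: contraT => yx.
  have un : uniq [:: y; x; u; v].
    by rewrite /= !inE uv (negbTE yx) (negbTE xu) (negbTE xv) (negbTE yu) (negbTE yv).
  have /andP[/forall_inP C3 _] := cC.
  have := uniq_leq_size (s2 := enum t) un; rewrite -cardE (eqP (C3 t tC)) /=.
  have sub : {subset [:: y; x; u; v] <= enum t}.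
    by move=> w; rewrite mem_enum !inE => /or4P[]/eqP->.
  by move/(_ sub).
have at_end w x : w \in [set u; v] -> x != u -> x != v -> ~~ odd (codeg Q' w x).
  move=> hw xu xv; have [xQ|nxQ] := boolP (x \in cover Q).
    have -> : codeg Q' w x = codeg C w x.
      apply: eq_card => t; rewrite !inE; apply/andP/andP => -[tQ' wx]; split=> //.
        by apply: (subsetP sQ'); rewrite !inE.
      case/andP: wx => wt xt.
      have [/andP[ut vt]|nuv] := boolP ((u \in t) && (v \in t)).
        by rewrite tQ' ut vt /=; apply/orP; right; apply/existsP; exists x; rewrite xu xv xt.
      case: (boolP (t \in Q)) => //= tQ; case/negP: (sep x xu xv xQ).
      by apply/mem_coverP; exists t; rewrite // !inE tQ tQ' nuv.
    apply: hC; by move: hw => /set2P[]->; rewrite eq_sym.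
  rewrite (_ : codeg Q' w x = 0) //; apply/eqP; rewrite cards_eq0; apply/eqP/setP => t.
  rewrite !inE; apply/negbTE/negP => /and3P[/orP[tQ|hh] wt xt].
    by case/negP: nxQ; apply/mem_coverP; exists t.
  move: hh => /and4P[tC ut vt /existsP[y /and4P[yu yv yt yQ]]].
  by case/negP: nxQ; rewrite -(third t x tC ut vt xt xu xv y yt yu yv).
have cQ' : mod2_cycle Q'.
  rewrite /mod2_cycle Q'3; apply/forallP => x; apply/forallP => y; apply/implyP => xy.
  have [exu|xu] := eqVneq x u; last have [exv|xv] := eqVneq x v.
  (* The parity at the pair [u v] follows from the other pairs at [u] by the handshake. *)
  - have [eyv|yv] := eqVneq y v.
      rewrite exu; apply: codeg_handshake => //; first by rewrite eyv.
      by move=> z zu zy; apply: at_end; rewrite ?set21 // -eyv.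
    by rewrite exu; apply: at_end; rewrite ?set21 // -exu eq_sym.
  - have [eyu|yu] := eqVneq y u.
      rewrite exv; apply: codeg_handshake => //; first by rewrite eyu eq_sym.
      by move=> z zu zy; apply: at_end; rewrite ?set22 // -eyu.
    by rewrite exv; apply: at_end; rewrite ?set22 // -exv eq_sym.
  - have [->|yu] := eqVneq y u; first by rewrite codegC at_end ?set21.
    have [->|yv] := eqVneq y v; first by rewrite codegC at_end ?set22.
    rewrite (_ : codeg Q' x y = codeg Q x y).
      by have /rel_cycleP[h _ _ _] := rQ; apply: h.
    apply: eq_card => t; rewrite !inE; case: (t \in Q) => //=.
    apply/negbTE/negP => /andP[/and4P[tC ut vt _] /andP[xt yt]].
    by have /eqP := third t x tC ut vt xt xu xv y yt yu yv; rewrite eq_sym (negbTE xy).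
have eQ' : Q' = C.
  apply: minC => //; case/set0Pn: Q0 => s sQ''; apply/set0Pn; exists s.
  by rewrite inE sQ''.
have -> : cover C = cover Q :|: [set u; v].
  apply/setP => x; rewrite !inE; apply/mem_coverP/idP.
    move=> [t]; rewrite -{1}eQ' inE => /orP[tQ xt|].
      by apply/orP; left; apply/mem_coverP; exists t.
    rewrite inE => /and4P[tC ut vt /existsP[y /and4P[yu yv yt yQ]]] xt.
    have [_|xu] := eqVneq x u; first by rewrite /= orbT.
    have [_|xv] := eqVneq x v; first by rewrite /= orbT.
    by rewrite (third t y tC ut vt yt yu yv x xt xu xv) yQ.
  case/orP=> [/mem_coverP[t tQ xt]|hx].
    by exists t => //; apply: (subsetP sC); apply: (subsetP sQ).
  have /graph_ofP[_ [t tC /andP[ut vt]]] := Cuv; exists t => //.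
  by case/orP: hx => /eqP->.
exact: gQ.
Qed.
End Piece.

End Contraction.

Theorem minimal_cycle_grigid C : minimal_in mod2_cycle C ->
  grigid (cover C) (graph_of C).
Proof.
have [n] := ubnP #|cover C|; elim: n C => [//|n ihn] C hn Cmin.
have [cC C0 minC] := Cmin; have /andP[/forall_inP C3 /forallP hC] := cC.
have /set0Pn[t tC] := C0.
have [u [v [w [et /and3P[uv vw uw]]]]] := card3_set (eqP (C3 t tC)).
have Cuv : graph_of C u v.
  by apply/graph_ofP; split=> //; exists t; rewrite // et !inE !eqxx orbT.
have IH D : minimal_in mod2_cycle D -> #|cover D| < #|cover C| ->
    grigid (cover D) (graph_of D).
  by move=> mD lt; apply: ihn mD; apply: leq_trans (lt) (ltnSE hn).
(* Evenness forces a second triple through [u w]; it cannot contain [v], so it survives the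
   contraction. *)
have [s sC0] : exists s, s \in off_edge u v C.
  have := forallP (hC u) w; rewrite uw /= => ev.
  have tuw : t \in [set t in C | (u \in t) && (w \in t)].
    by rewrite inE tC et !inE !eqxx !orbT.
  move: ev; rewrite /codeg (cardsD1 t) tuw.
  case: (set_0Vmem ([set t in C | (u \in t) && (w \in t)] :\ t)) => [->|[s]]; first by rewrite cards0.
  rewrite !inE => /and4P[st sC us ws] _.
  exists s; rewrite inE sC us /=; apply: contra st => vs.
  rewrite eq_sym eqEcard (eqP (C3 _ tC)) (eqP (C3 _ sC)) leqnn andbT et.
  by apply/subsetP => x; rewrite !inE => /orP[/orP[]|]/eqP->.
have rC := off_edge_rel_cycle uv cC.
have [P [minP sP sPC]] := minimal_in_exists (@rel_cycleD u v) rC sC0.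
have [rP P0 _] := minP.
exact: (pieces_grigid uv Cmin Cuv IH (ltnSn _) sPC P0 rP (piece_grigid uv Cmin Cuv IH sPC minP)).
Qed.

End MinimalCycles.
Arguments mod2_cycle {V} C.

(** * Balanced normal pseudomanifolds *)

Lemma connect_ind_prop (T : finType) (e : rel T) (B : T -> Prop) x y :
  (forall x y, e x y -> B x -> B y) -> connect e x y -> B x -> B y.
Proof.
move=> step /connectP[p]; elim: p x => [|z p ih] x /=; first by move=> _ ->.
by move=> /andP[xz pz] ey /(step _ _ xz); apply: ih.
Qed.

Section Pseudomanifolds.
Variable V : finType.
Implicit Types (K : {set {set V}}) (s t F : {set V}) (d : nat).

Lemma facet_mem K F : F \in facets K -> F \in K.
Proof. by rewrite inE => /andP[]. Qed.

Lemma facet_exists K s : s \in K -> exists2 F, F \in facets K & s \subset F.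
Proof.
move=> sK; have [|F /maxsetP[FK maxF] sF] := @maxset_exists _ (mem K) s; first by [].
exists F => //; rewrite inE [_ \in K]FK /=; apply/forall_inP => t tK; apply/implyP => Ft.
by rewrite (maxF t).
Qed.

(* Normality makes every two facets through a common face adjacent through a
   chain of facets containing that face, by descending induction on the face. *)
Lemma facets_strongly_connected d K (A : {set V} -> Prop) :
  normal_pseudomanifold d K -> 1 < d ->
  (forall F F', F \in facets K -> F' \in facets K -> #|F :&: F'| = d - 1 -> A F -> A F') ->
  (exists2 F, F \in facets K & A F) -> forall F, F \in facets K -> A F.
Proof.
move=> [[K0 dK] _ pK _ lK] d1 step [F0 hF0 AF0].
suff main n s : d - #|s| <= n -> s \in K -> forall F F', F \in facets K ->
    F' \in facets K -> s \subset F -> s \subset F' -> A F -> A F'.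
  move=> F hF; apply: (main d set0 _ _ F0) => //; rewrite ?sub0set //; lia.
elim: n s => [|n ihn] s hs sK F F' hF hF' sF sF' AF.
  have es : s = F by apply/eqP; rewrite eqEcard sF (pK F hF); lia.
  have es' : s = F' by apply/eqP; rewrite eqEcard sF' (pK F' hF'); lia.
  by rewrite -es' es.
have [le|lt] := leqP #|s| (d - 2); last first.
  have := subset_leq_card (subsetIl F F'); rewrite (pK F hF) => h1.
  have h2 : #|s| <= #|F :&: F'| by apply: subset_leq_card; rewrite subsetI sF.
  have [e|ne] := eqVneq #|F :&: F'| d; last by apply: (step F) => //; lia.
  have eF : F :&: F' = F by apply/eqP; rewrite eqEcard subsetIl (pK F hF) e leqnn.
  suff -> : F' = F by [].
  by apply/esym/eqP; rewrite eqEcard -{1}eF subsetIr (pK F hF) (pK F' hF') leqnn.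
have outside G : G \in facets K -> s \subset G -> exists2 u, u \in G & u \notin s.
  move=> hG sG; have /properP[_ [u uG us]] : s \proper G.
    by rewrite properEcard sG (pK G hG); move: d1 le; clear; lia.
  by exists u.
have lkv G u : G \in facets K -> s \subset G -> u \in G -> u \notin s ->
    [set u] \in link K s.
  move=> hG sG uG us; have GK := facet_mem hG; rewrite inE; apply/and3P; split.
  - by apply: dK GK _; rewrite sub1set.
  - by rewrite disjoint_sym disjoints1.
  - by apply: dK GK _; rewrite subUset sG sub1set.
have [u uF us] := outside F hF sF; have [w wF' ws] := outside F' hF' sF'.
have con := lK s sK le u w (lkv F u hF sF uF us) (lkv F' w hF' sF' wF' ws).
have grow x : x \notin s -> d - #|s :|: [set x]| <= n.
  move=> xs; rewrite setUC cardsU1 xs add1n subnS -subn1 leq_subLR add1n.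
  exact: hs.
pose B x := x \notin s /\ forall G, G \in facets K -> s :|: [set x] \subset G -> A G.
have Bw : B w.
  apply: (connect_ind_prop _ con).
    move=> x y /andP[xy]; rewrite inE => /and3P[_ dis sxyK] [xs Bx].
    have ys : y \notin s.
      by apply: contraTN dis => ys; apply/pred0Pn; exists y; rewrite /= ys !inE eqxx orbT.
    split=> // G hG syG.
    have [G0 hG0 sG0] := facet_exists sxyK.
    have sy : s :|: [set y] \subset s :|: [set x; y].
      by apply: setUS; rewrite sub1set !inE eqxx orbT.
    have sx : s :|: [set x] \subset s :|: [set x; y].
      by apply: setUS; rewrite sub1set !inE eqxx.
    apply: (ihn (s :|: [set y]) (grow y ys) _ G0) => //.
    - exact: dK sxyK sy.
    - exact: subset_trans sy sG0.
    - by apply: Bx => //; apply: subset_trans sx sG0.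
  split=> // G hG suG.
  have suF : s :|: [set u] \subset F by rewrite subUset sF sub1set.
  apply: (ihn (s :|: [set u]) (grow u us) _ F) => //.
  by apply: dK (facet_mem hF) suF.
by case: Bw => _; apply=> //; rewrite subUset sF' sub1set.
Qed.

(** * Rigidity of the graph on three colours *)

Section Coloured.
Variables (d : nat) (K : {set {set V}}) (kappa : V -> 'I_d) (T : {set 'I_d}).
Hypothesis d2 : 2 < d.
Hypothesis normK : normal_pseudomanifold d K.
Hypothesis kappaP : forall u v, edge_rel K u v -> kappa u != kappa v.
Hypothesis T3 : #|T| = 3.

Let dK s t : t \in K -> s \subset t -> s \in K.
Proof. by case: normK => -[_ h] _ _ _ _; apply: h. Qed.

Let pK F : F \in facets K -> #|F| = d.
Proof. by case: normK => _ _ h _ _; apply: h. Qed.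

Let ridge s : s \in K -> #|s| = d - 1 -> #|[set F in facets K | s \subset F]| = 2.
Proof. by case: normK => _ _ _ h _; apply: h. Qed.

Lemma kappa_inj s : s \in K -> {in s &, injective kappa}.
Proof.
move=> sK x y xs ys e; apply/eqP; apply: contraT => nxy.
have : kappa x != kappa y.
  apply: kappaP; rewrite /edge_rel nxy /=; apply: dK sK _.
  by apply/subsetP => z /set2P[] ->.
by rewrite e eqxx.
Qed.

Lemma kappa_facet F c : F \in facets K -> exists2 x, x \in F & kappa x = c.
Proof.
move=> hF; have : kappa @: F = setT.
  apply/eqP; rewrite eqEcard subsetT cardsT card_ord card_in_imset ?(pK hF) ?leqnn //.
  exact: kappa_inj (facet_mem hF).
by move/setP/(_ c); rewrite inE => /imsetP[x xF ->]; exists x.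
Qed.

Definition sel F := [set x in F | kappa x \in T].
Definition rest F := [set x in F | kappa x \notin T].

Lemma sel_rest F : sel F :|: rest F = F.
Proof. by apply/setP => x; rewrite !inE -andb_orr orbN andbT. Qed.

Lemma sel_rest_disj F : sel F :&: rest F = set0.
Proof. by apply/setP => x; rewrite !inE; case: (kappa x \in T); rewrite ?andbF. Qed.

Lemma card_sel F : F \in facets K -> #|sel F| = 3.
Proof.
move=> hF; rewrite -T3 -(card_in_imset (f := kappa) (D := mem (sel F))).
  apply: eq_card => c; apply/imsetP/idP => [[x]|cT].
    by rewrite inE => /andP[_ h ->].
  by have [x xF e] := kappa_facet c hF; exists x; rewrite // inE xF e.
move=> x y; rewrite !inE => /andP[xF _] /andP[yF _].
exact: kappa_inj (facet_mem hF) _ _ xF yF.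
Qed.

Lemma card_rest F : F \in facets K -> #|rest F| = d - 3.
Proof.
move=> hF; have := cardsUI (sel F) (rest F).
rewrite sel_rest sel_rest_disj cards0 (card_sel hF) (pK hF); clear; lia.
Qed.

(** The triangles of the link of [F]. No colours are imposed: when [F] is the rest of a facet, its
    vertices already use up all colours outside [T]. *)
Definition lkT F : {set {set V}} := [set t : {set V} | [&& #|t| == 3, [disjoint t & F] & t :|: F \in facets K]].

Lemma lkT_sel F t : F \in facets K -> t \in lkT (rest F) -> sel (t :|: rest F) = t.
Proof.
move=> hF; rewrite inE => /and3P[_ dis htF].
apply/setP => x; rewrite !inE; apply/idP/idP.
  by move=> /andP[/orP[//|/andP[_ /negbTE->]]].
move=> xt; rewrite xt /=; apply: contraT => nT.
have [y yF e] := kappa_facet (kappa x) hF.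
have yr : y \in rest F by rewrite inE yF e.
have exy : x = y.
  by apply: (kappa_inj (facet_mem htF)); rewrite ?e // !(inE, xt) // yF e nT orbT.
by case/pred0Pn: dis; exists x; rewrite /= xt exy yr.
Qed.

Lemma sel_lkT F : F \in facets K -> sel F \in lkT (rest F).
Proof.
by move=> hF; rewrite inE card_sel // sel_rest hF -setI_eq0 sel_rest_disj !eqxx.
Qed.

Lemma lkT_facets F x y : F \in facets K -> x != y ->
  forall t, t \in lkT (rest F) -> x \in t -> y \in t ->
  [/\ rest F :|: [set x; y] \in K, #|rest F :|: [set x; y]| = d - 1 &
      rest F :|: [set x; y] \subset t :|: rest F].
Proof.
move=> hF xy t; rewrite inE => /and3P[_ dis htF] xt yt.
have sub : rest F :|: [set x; y] \subset t :|: rest F.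
  rewrite subUset subsetUr /=; apply/subsetP => z /set2P[] ->; by rewrite inE (xt, yt).
split=> //; first exact: dK (facet_mem htF) sub.
have := cardsUI (rest F) [set x; y]; rewrite cards2 xy card_rest //.
have -> : rest F :&: [set x; y] = set0.
  apply/eqP; rewrite setI_eq0 disjoint_sym; apply: disjointWl dis.
  by apply/subsetP => z /set2P[] ->.
rewrite cards0; lia.
Qed.

(** Together with [rest F], a pair [x y] in such a triangle spans a face with [d - 1] vertices, and
    its two facets correspond to the triangles through [x y]. So every codegree is 0 or 2. *)
Lemma lkT_cycle F : F \in facets K -> mod2_cycle (lkT (rest F)).
Proof.
move=> hF; apply/andP; split.
  by apply/forall_inP => t; rewrite inE => /and3P[].
apply/forallP => x; apply/forallP => y; apply/implyP => xy.
have [e|[t]] := set_0Vmem [set t in lkT (rest F) | (x \in t) && (y \in t)].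
  by rewrite /codeg e cards0.
rewrite inE => /and3P[ht xt yt].
have [sK sc ss] := lkT_facets hF xy ht xt yt.
have e := ridge sK sc; rewrite /codeg.
suff -> : #|[set t in lkT (rest F) | (x \in t) && (y \in t)]| = 2 by [].
rewrite -e -[LHS](card_in_imset (f := fun t : {set V} => t :|: rest F)).
  apply: eq_card => G; rewrite [in RHS]in_set; apply/imsetP/andP.
    move=> [r]; rewrite in_set => /and3P[hr xr yr ->]; split.
      by move: hr; rewrite inE => /and3P[].
    by have [] := lkT_facets hF xy hr xr yr.
  move=> [hG' sG].
  have rG : rest F \subset G by apply: subset_trans sG; apply: subsetUl.
  exists (G :\: rest F); last by rewrite setUC setDE setUIr setUCr setIT; apply/esym/setUidPr.
  have nr z : z \in t -> z \notin rest F.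
    move=> zt; move: ht; rewrite inE => /and3P[_ /disjointFr dis _].
    by rewrite dis.
  have inG z : z \in [set x; y] -> z \in G.
    by move=> hz; apply: (subsetP sG); rewrite inE hz orbT.
  rewrite inE in_setD (nr x xt) (inG x (set21 _ _)) in_setD (nr y yt) (inG y (set22 _ _)).
  rewrite andbT inE cardsDS // (pK hG') card_rest // subKn // eqxx /=.
  rewrite setUC setDE setUIr setUCr setIT (setUidPr rG) hG' andbT.
  by rewrite -setI_eq0 -setIA [~: _ :&: _]setIC setICr setI0 eqxx. 
move=> r q; rewrite !inE => /andP[/and3P[_ dr _] _] /andP[/and3P[_ dq _] _] erq.
have cut (r' : {set V}) : [disjoint r' & rest F] -> (r' :|: rest F) :\: rest F = r'.
  by move=> h; rewrite setDUl setDv setU0; apply/setDidPl.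
by rewrite -(cut r dr) -(cut q dq) erq.
Qed.

Definition edgeT : rel V :=
  fun x y => [&& edge_rel K x y, kappa x \in T & kappa y \in T].

(** More than [sel F \subset U]: a whole minimal cycle inside [U] guarantees that the selected
    triple of an adjacent facet lies in [U] too. *)
Definition covered F (U : {set V}) := exists2 C, minimal_in mod2_cycle C &
  [/\ sel F \in C, C \subset lkT (rest F) & cover C \subset U].

Lemma covered_grigid F C : F \in facets K -> minimal_in mod2_cycle C ->
  C \subset lkT (rest F) -> grigid (cover C) edgeT.
Proof.
move=> hF minC sC; apply: grigid_mono (minimal_cycle_grigid minC).
move=> x y _ _ /graph_ofP[xy [t /(subsetP sC) ht /andP[xt yt]]].
have e := lkT_sel hF ht.
have [sK _ _] := lkT_facets hF xy ht xt yt.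
apply/and3P; split.
- by rewrite /edge_rel xy; apply: dK sK _; apply: subsetUr.
- by move: xt; rewrite -e inE => /andP[].
- by move: yt; rewrite -e inE => /andP[].
Qed.

(* Either both facets select the same triple, or the two selected triples are
   the only two members of the link cycle through their common edge, so a
   subcycle containing one contains the other. *)
Lemma covered_adjacent F F' C : F \in facets K -> F' \in facets K ->
  #|F :&: F'| = d - 1 -> minimal_in mod2_cycle C -> sel F \in C ->
  C \subset lkT (rest F) -> sel F' \subset cover C.
Proof.
move=> hF hF' cI [cC C0 _] sF sC.
have in_cov t : t \in C -> t \subset cover C by move=> tC; apply: bigcup_sup tC.
have e : #|sel F :&: sel F'| + #|rest F :&: rest F'| = d - 1.
  rewrite -cI -cardsUI [X in _ + X = _](_ : _ = 0); last first.
    apply/eqP; rewrite cards_eq0; apply/eqP/setP => x; rewrite !inE.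
    by case: (kappa x \in T); rewrite ?andbF.
  rewrite addn0; apply: eq_card => x; rewrite !inE.
  by case: (kappa x \in T); rewrite ?andbT ?andbF ?orbF.
have h1 := subset_leq_card (subsetIl (sel F) (sel F')).
have h2 := subset_leq_card (subsetIl (rest F) (rest F')).
rewrite card_sel // in h1; rewrite card_rest // in h2.
have [e3|ne3] := eqVneq #|sel F :&: sel F'| 3.
  have <- : sel F = sel F'.
    have es : sel F :&: sel F' = sel F.
      by apply/eqP; rewrite eqEcard subsetIl card_sel // e3.
    by apply/eqP; rewrite eqEcard -{1}es subsetIr !card_sel.
  exact: in_cov.
have c2 : #|sel F :&: sel F'| == 2 by lia.
have cr : #|rest F :&: rest F'| = d - 3 by lia.
have er : rest F = rest F'.
  have es : rest F :&: rest F' = rest F.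
    by apply/eqP; rewrite eqEcard subsetIl card_rest // cr leqnn.
  by apply/eqP; rewrite eqEcard -{1}es subsetIr !card_rest ?leqnn.
have /cards2P[x [y [xy exy]]] := c2.
have [xs ys] : x \in sel F :&: sel F' /\ y \in sel F :&: sel F' by rewrite exy set21 set22.
move: xs ys => /setIP[xF xF'] /setIP[yF yF'].
have [sK sc _] := lkT_facets hF xy (sel_lkT hF) xF yF.
have FF' : F != F'.
  by apply: contraNneq ne3 => <-; rewrite setIid card_sel.
have two : [set G in facets K | rest F :|: [set x; y] \subset G] = [set F; F'].
  apply/esym/eqP; rewrite eqEcard cards2 FF' (ridge sK sc) leqnn andbT.
  have sub G : x \in sel G -> y \in sel G -> rest G :|: [set x; y] \subset G.
    rewrite !inE => /andP[xG _] /andP[yG _]; rewrite subUset; apply/andP; split.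
      by apply/subsetP => z; rewrite inE => /andP[].
    by apply/subsetP => z /set2P[] ->.
  apply/subsetP => G /set2P[] ->; rewrite inE ?hF ?hF' /=; first exact: sub.
  by rewrite er; apply: sub.
have [t tC [xt yt tF]] : exists2 t, t \in C & [/\ x \in t, y \in t & t != sel F].
  have /andP[_ /forallP/(_ x)/forallP/(_ y)] := cC; rewrite xy /= => ev.
  have sFxy : sel F \in [set t in C | (x \in t) && (y \in t)] by rewrite inE sF xF yF.
  move: ev; rewrite /codeg (cardsD1 (sel F)) sFxy.
  have [->|[t]] := set_0Vmem ([set t in C | (x \in t) && (y \in t)] :\ sel F).
    by rewrite cards0.
  by rewrite !inE => /and4P[ne tC xt yt] _; exists t.
have htl := subsetP sC t tC.
have [_ _ sub] := lkT_facets hF xy htl xt yt.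
have : t :|: rest F \in [set F; F'].
  by rewrite -two inE sub andbT; move: htl; rewrite inE => /and3P[].
case/set2P=> eF; last by rewrite -eF (lkT_sel hF htl); apply: in_cov.
by move: tF; rewrite -eF (lkT_sel hF htl) eqxx.
Qed.

Lemma covered_exists F : F \in facets K -> exists2 C, minimal_in mod2_cycle C &
  sel F \in C /\ C \subset lkT (rest F).
Proof.
move=> hF; have [C [mC sC lC]] := minimal_in_exists (@mod2_cycleD V) (lkT_cycle hF) (sel_lkT hF).
by exists C.
Qed.

(** [U] is enlarged until being covered passes across every ridge; then all facets are covered. If
    it does not pass to [F'], the selected triple of [F'] still lies in [U], and a minimal cycle
    through it is glued there. That cycle is not inside [U], so [U] strictly grows. *)
Lemma grigid_colours : exists2 U, grigid U edgeT &
  forall F, F \in facets K -> sel F \subset U.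
Proof.
have [F0 hF0 _] : exists2 F, F \in facets K & set0 \subset F.
  by apply: facet_exists; case: normK => -[].
have [C0 mC0 [sC0 lC0]] := covered_exists hF0.
suff main k U : #|~: U| < k -> grigid U edgeT ->
    (exists2 F, F \in facets K & covered F U) ->
    exists2 U, grigid U edgeT & forall F, F \in facets K -> sel F \subset U.
  apply: (main _ (cover C0) (ltnSn _) (covered_grigid hF0 mC0 lC0)).
  by exists F0 => //; exists C0.
elim: k U => [//|k ihk] U hk gU hcov.
have [adj|nadj] := pselect (forall F F', F \in facets K -> F' \in facets K ->
    #|F :&: F'| = d - 1 -> covered F U -> covered F' U).
  exists U => // F hF.
  have [C _ [sF _ sCU]] := facets_strongly_connected normK (ltnW d2) adj hcov hF.
  by apply: subset_trans sCU; apply: bigcup_sup sF.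
have [F [F' [hF hF' cI covF ncov]]] : exists F F', [/\ F \in facets K, F' \in facets K,
    #|F :&: F'| = d - 1, covered F U & ~ covered F' U].
  apply: contrapT => h; apply: nadj => F F' hF hF' cI covF.
  by apply: contrapT => ncov; apply: h; exists F, F'.
have [C mC [sF sC sCU]] := covF.
have sF' := covered_adjacent hF hF' cI mC sF sC.
have [C' mC' [sFC' sC']] := covered_exists hF'.
have gC' := covered_grigid hF' mC' sC'.
apply: (ihk (U :|: cover C')).
- rewrite -ltnS; apply: leq_trans hk; rewrite ltnS; apply: proper_card.
  rewrite properC; apply/properP; split; first exact: subsetUl.
  have /subsetPn[x xC xU] : ~~ (cover C' \subset U).
    by apply/negP => sub; apply: ncov; exists C'.
  by exists x => //; rewrite inE xC orbT.
- have [x [y [z [es /and3P[xy yz xz]]]]] := card3_set (card_sel hF').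
  have inb (W : {set V}) : sel F' \subset W -> [&& x \in W, y \in W & z \in W].
    by move=> /subsetP sW; rewrite !sW // es !inE eqxx ?orbT.
  apply: (@grigid_glue _ _ _ _ x y z) => //.
  + by rewrite xy yz xz.
  + by apply: inb; apply: subset_trans sCU.
  + by apply: inb; apply: bigcup_sup sFC'.
exists F' => //; exists C' => //; split=> //; exact: subsetUr.
Qed.

Lemma colour_triple_bound :
  3 * #|[set v | ([set v] \in K) && (kappa v \in T)]| <=
  #|[set e in faces K 2 | [forall x in e, kappa x \in T]]| + 6.
Proof.
have [U gU sU] := grigid_colours.
have := grigid_card (F := [set e in faces K 2 | [forall x in e, kappa x \in T]]) _ gU.
move=> h; apply: leq_trans (h _).
  rewrite leq_mul2l /=; apply/subset_leq_card/subsetP => v; rewrite inE => /andP[vK vT].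
  have [F hF vF] := facet_exists vK; apply: (subsetP (sU F hF)).
  by rewrite inE vT andbT -sub1set.
move=> x y _ _ /and3P[/andP[xy xyK] xT yT]; rewrite !inE xyK cards2 xy /=.
by apply/forall_inP => z /set2P[] ->.
Qed.

End Coloured.

(** * Summation over triples of colours *)

Lemma card_triples_containing d (S : {set 'I_d}) : #|S| <= 3 ->
  #|[set T : {set 'I_d} | (#|T| == 3) && (S \subset T)]| = 'C(d - #|S|, 3 - #|S|).
Proof.
move=> S3.
have -> : d - #|S| = #|~: S| by rewrite [RHS]cardsCs setCK card_ord.
rewrite -cards_draws -[RHS](card_in_imset (f := fun B : {set 'I_d} => B :|: S)).
  apply: eq_card => T; rewrite !inE; apply/andP/imsetP => [[/eqP T3 ST]|[B]].
    exists (T :\: S); last by rewrite setUC setDE setUIr setUCr setIT; apply/esym/setUidPr.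
    by rewrite inE cardsDS // T3 eqxx andbT subsetDr.
  rewrite inE => /andP[BS /eqP cB ->]; split; last exact: subsetUr.
  have := cardsUI B S; rewrite (disjoint_setI0 _) ?cards0 ?addn0; last first.
    by rewrite disjoints_subset.
  by move=> ->; rewrite cB subnK.
have cut (B : {set 'I_d}) : B \subset ~: S -> (B :|: S) :\: S = B.
  by move=> h; rewrite setDUl setDv setU0; apply/setDidPl; rewrite disjoints_subset.
move=> B B'; rewrite !inE => /andP[sB _] /andP[sB' _] e.
by rewrite -(cut B sB) -(cut B' sB') e.
Qed.

Lemma card_faces1 K : #|faces K 1| = #|[set v | [set v] \in K]|.
Proof.
rewrite -(card_imset (f := @set1 V)); last exact: set1_inj.
apply: eq_card => s; rewrite inE; apply/andP/imsetP => [[sK /cards1P[v es]]|[v]].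
  by exists v; rewrite // inE -es.
by rewrite inE => vK ->; rewrite cards1.
Qed.

(** A vertex lies in ['C(d - 1, 2)] colour triples and an edge in [d - 2], its ends having different
    colours, while the constant 6 occurs ['C(d, 3)] times. The factor [d - 2] common to the three
    terms is cancelled at the end. *)
Lemma balanced_edge_bound d K : 2 < d -> normal_pseudomanifold d K -> balanced d K ->
  3 * (d - 1) * #|faces K 1| <= 2 * #|faces K 2| + 2 * (d * (d - 1)).
Proof.
move=> d2 normK [kappa kP].
pose Ts := [set T : {set 'I_d} | #|T| == 3].
have bound : \sum_(T in Ts) 3 * #|[set v | ([set v] \in K) && (kappa v \in T)]| <=
    \sum_(T in Ts) (#|[set e in faces K 2 | [forall x in e, kappa x \in T]]| + 6).
  apply: leq_sum => T; rewrite inE => /eqP T3.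
  exact: (colour_triple_bound d2 normK kP T3).
have e0 : \sum_(T in Ts) #|[set v | ([set v] \in K) && (kappa v \in T)]| =
    #|faces K 1| * 'C(d - 1, 2).
  rewrite card_faces1 -sum_nat_const.
  under eq_bigr do rewrite -sum1_card.
  under eq_bigr do under eq_bigl do rewrite inE.
  rewrite (exchange_big_dep (mem [set v | [set v] \in K])) /=; last first.
    by move=> T v _ /andP[vK _]; rewrite inE.
  apply: eq_bigr => v; rewrite inE => vK.
  rewrite sum1_card -{1}(cards1 (kappa v)) -[2]/(3 - 1) -{2}(cards1 (kappa v)).
  rewrite -card_triples_containing ?cards1 //; apply: eq_card => T.
  by rewrite [RHS]inE sub1set unfold_in /= inE vK.
have e1 : \sum_(T in Ts) #|[set e in faces K 2 | [forall x in e, kappa x \in T]]| =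
    #|faces K 2| * (d - 2).
  rewrite -sum_nat_const.
  under eq_bigr do rewrite -sum1_card.
  under eq_bigr do under eq_bigl do rewrite inE.
  rewrite (exchange_big_dep (mem (faces K 2))) /=; last by move=> T e _ /andP[].
  apply: eq_bigr => e eK.
  have /andP[eK' /cards2P[x [y [xy exy]]]] : (e \in K) && (#|e| == 2).
    by move: eK; rewrite inE.
  have cxy : #|[set kappa x; kappa y]| = 2.
    by rewrite cards2 (kP x y) // /edge_rel xy -exy eK'.
  have := @card_triples_containing d [set kappa x; kappa y].
  rewrite cxy bin1 => <- //; rewrite sum1_card; apply: eq_card => T; rewrite [RHS]inE unfold_in /= !inE.
  congr (_ && _); move: eK; rewrite inE => /andP[eKK e2]; rewrite eKK e2 /=.
  rewrite exy; apply/forall_inP/subsetP => h z.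
    by move=> /set2P[] ->; apply: h; rewrite !inE eqxx ?orbT.
  by move=> /set2P[] ->; apply: h; rewrite !inE eqxx ?orbT.
have e2 : #|Ts| = 'C(d, 3) by rewrite /Ts card_draws card_ord.
move: bound; rewrite -big_distrr /= e0 big_split /= e1 sum_nat_const e2.
have b2 : 2 * 'C(d - 1, 2) = (d - 1) * (d - 2).
  by rewrite mul_bin_left bin1 mulnC -subnDA.
have b3 : 3 * 'C(d, 3) = (d - 2) * 'C(d, 2) by rewrite mul_bin_left.
have b4 : 2 * 'C(d, 2) = d * (d - 1) by rewrite mul_bin_left bin1 mulnC.
move=> h; rewrite -(@leq_pmul2r (d - 2)) ?subn_gt0 //.
rewrite mulnDl -mulnA [_ * (d - 2)]mulnC mulnA.
have -> : 3 * (d - 1) * (d - 2) * #|faces K 1| = 2 * (3 * (#|faces K 1| * 'C(d - 1, 2))).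
  by rewrite -(mulnA 3) -b2; lia.
have -> : 2 * (d * (d - 1)) * (d - 2) = 2 * ('C(d, 3) * 6).
  rewrite -b4 -!mulnA ['C(d, 2) * _]mulnC -b3; lia.
by rewrite -mulnA -mulnDr leq_mul2l.
Qed.

End Pseudomanifolds.

(** * Covers *)

Section VoltageCovers.
Variables (V : finType) (K : {set {set V}}) (n : nat) (tau : V -> V -> 'I_n -> 'I_n).
Implicit Types (s r : {set V}) (z q : {set V * 'I_n}) (x y : V * 'I_n).

(* [tau u v] transports the fibre over [u] to the fibre
   over [v], and a face of the cover is a transported copy of a face of [K]. *)
Definition cover_complex : {set {set V * 'I_n}} :=
  [set z : {set V * 'I_n} | ([set x.1 | x in z] \in K) &&
     [forall x in z, forall y in z, y.2 == tau x.1 y.1 x.2]].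

(** The vertices may coincide, so edges are included: [w = u] makes [tau v u] inverse to [tau u v].
    For three distinct vertices this says that the holonomy around a triangle is trivial. *)
Definition flat_voltage :=
  (forall u i, [set u] \in K -> tau u u i = i) /\
  (forall u v w i, [set u; v; w] \in K -> tau v w (tau u v i) = tau u w i).

(** The only face of the cover over [s] through [x], when [s] is a face containing [x.1]. *)
Definition lift_face s x : {set V * 'I_n} := [set (w, tau x.1 w x.2) | w in s].

Notation pr z := [set x.1 | x in z].

Hypothesis scK : simplicial_complex K.
Hypothesis flat : flat_voltage.

Let dK s r : r \in K -> s \subset r -> s \in K.
Proof. by case: scK => _; apply. Qed.

Lemma cover_complexP z : reflect
  (pr z \in K /\ forall x y, x \in z -> y \in z -> y.2 = tau x.1 y.1 x.2)
  (z \in cover_complex).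
Proof.
rewrite inE; apply: (iffP andP) => -[h1 h2]; split=> //.
  by move=> x y xz yz; apply/eqP; apply: (forall_inP (forall_inP h2 x xz)).
by apply/forall_inP => x xz; apply/forall_inP => y yz; apply/eqP; apply: h2.
Qed.

Lemma pr_lift s x : pr (lift_face s x) = s.
Proof.
apply/setP => w; apply/imsetP/idP => [[y /imsetP[v vs ->] ->]//|ws].
by exists (w, tau x.1 w x.2) => //; apply/imsetP; exists w.
Qed.

Lemma lift_face_cover s x : s \in K -> x.1 \in s -> lift_face s x \in cover_complex.
Proof.
move=> sK xs; apply/cover_complexP; rewrite pr_lift; split=> //.
move=> _ _ /imsetP[v vs ->] /imsetP[w ws ->] /=.
case: flat => _ ->//; apply: dK sK _.
by apply/subsetP => u; rewrite !inE => /orP[/orP[]|]/eqP->.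
Qed.

Lemma mem_lift_face s x : s \in K -> x.1 \in s -> x \in lift_face s x.
Proof.
move=> sK xs; apply/imsetP; exists x.1 => //; case: flat => -> /=; first by case: x {xs}.
by apply: dK sK _; rewrite sub1set.
Qed.

Lemma cover_face_lift z x : z \in cover_complex -> x \in z -> z = lift_face (pr z) x.
Proof.
move=> /cover_complexP[zK h] xz; apply/setP => y; apply/idP/imsetP.
  move=> yz; exists y.1; first exact: imset_f.
  by rewrite -(h x y) //; case: y {yz}.
by move=> [w /imsetP[y' yz ->] ->]; rewrite -(h x y') //; case: y' yz.
Qed.

Lemma cover_down z q : q \in cover_complex -> z \subset q -> z \in cover_complex.
Proof.
move=> /cover_complexP[qK h] /subsetP zq; apply/cover_complexP; split.
  by apply: dK qK _; apply: imsetS; apply/subsetP.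
by move=> x y /zq xq /zq yq; apply: h.
Qed.

Lemma pr_inj z : z \in cover_complex -> {in z &, injective fst}.
Proof.
move=> /cover_complexP[zK h] x y xz yz e; have := h x y xz yz; rewrite -e.
case: flat => -> => [_ e2|]; first by case: x y e e2 {xz yz} => [a b] [c f] /= -> ->.
by apply: dK zK _; rewrite sub1set; apply: imset_f.
Qed.

Lemma card_pr z : z \in cover_complex -> #|pr z| = #|z|.
Proof. by move=> hz; rewrite card_in_imset //; apply: pr_inj. Qed.

Lemma mem_pr z x : x \in z -> x.1 \in pr z.
Proof. exact: imset_f. Qed.

Lemma lift_faceS s r x : s \subset r -> lift_face s x \subset lift_face r x.
Proof. exact: imsetS. Qed.

(** The lifts of a face are indexed by the fibre over any one of its vertices. The empty face has a
    single lift, hence the condition on [k]. *)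
Lemma card_cover_faces k : 0 < k -> #|faces cover_complex k| = #|faces K k| * n.
Proof.
move=> k0; rewrite -sum_nat_const.
transitivity (\sum_(s in faces K k) #|[set z in faces cover_complex k | pr z == s]|).
  rewrite -sum1_card (partition_big (fun z => pr z) (mem (faces K k))) /=.
    apply: eq_bigr => s _; rewrite -sum1_card; apply: eq_bigl => z.
    by rewrite [RHS]inE.
  move=> z; rewrite in_set => /andP[hz zk]; have /cover_complexP[zK _] := hz.
  by rewrite !inE zK card_pr.
apply: eq_bigr => s; rewrite inE => /andP[sK /eqP sk].
have /card_gt0P[v vs] : 0 < #|s| by rewrite sk.
rewrite -[RHS]card_ord -cardsT -(card_in_imset (f := fun i => lift_face s (v, i))).
  apply: eq_card => z; rewrite in_set; apply/andP/imsetP.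
    rewrite in_set => -[/andP[hz zk] /eqP es]; have := vs; rewrite -{1}es => /imsetP[[v' i] xz /= e].
    exists i => //; rewrite -es e; exact: cover_face_lift.
  move=> [i _ ->]; have hl := @lift_face_cover s (v, i) sK vs.
  by rewrite in_set hl -(card_pr hl) pr_lift sk !eqxx.
move=> i j _ _ /setP/(_ (v, i)); rewrite (@mem_lift_face s (v, i)) // => /esym.
move=> h; have := pr_inj (@lift_face_cover s (v, j) sK vs) h (@mem_lift_face s (v, j) sK vs) erefl.
by case.
Qed.

Lemma cover_facet z : z \in facets cover_complex -> z != set0 -> pr z \in facets K.
Proof.
rewrite inE => /andP[hz /forall_inP maxz] /set0Pn[x xz].
have /cover_complexP[zK _] := hz.
rewrite inE zK; apply/forall_inP => r rK; apply/implyP => zr.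
have xr : x.1 \in r by apply: (subsetP zr); apply: mem_pr.
have /eqP e : lift_face r x == z.
  apply: (implyP (maxz _ (lift_face_cover rK xr))).
  by rewrite {1}(cover_face_lift hz xz); apply: lift_faceS.
by rewrite -(pr_lift r x) e.
Qed.

Lemma lift_facet s x : s \in facets K -> x.1 \in s -> lift_face s x \in facets cover_complex.
Proof.
rewrite inE => /andP[sK /forall_inP maxs] xs.
rewrite inE lift_face_cover //; apply/forall_inP => q hq; apply/implyP => sq.
have xq : x \in q by apply: (subsetP sq); apply: mem_lift_face.
have /cover_complexP[qK _] := hq.
have /eqP e : pr q == s.
  by apply: (implyP (maxs _ qK)); rewrite -(pr_lift s x); apply: imsetS.
by rewrite (cover_face_lift hq xq) e.
Qed.

(** The facets through a nonempty face and its link correspond to those of its projection. The link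
    of the empty face is the cover itself, whose connectedness is therefore a hypothesis. *)
Lemma cover_normal d : 2 < d -> 0 < n -> normal_pseudomanifold d K ->
  connected_complex cover_complex -> normal_pseudomanifold d cover_complex.
Proof.
move=> d2 n0 [_ _ pK ridge lK] conn.
have K0 : set0 \in K by case: scK.
have c0 : set0 \in cover_complex.
  by apply/cover_complexP; rewrite imset0; split=> // x y; rewrite inE.
have facet_n0 z : z \in facets cover_complex -> z != set0.
  rewrite inE => /andP[hz /forall_inP maxz]; apply/eqP => z0.
  have [F hF _] := facet_exists K0.
  have /card_gt0P[v vF] : 0 < #|F| by rewrite (pK F hF); apply: ltn_trans d2.
  have hl := @lift_face_cover F (v, Ordinal n0) (facet_mem hF) vF.
  have := implyP (maxz _ hl); rewrite z0 sub0set => /(_ isT)/eqP e.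
  by have := mem_lift_face (x := (v, Ordinal n0)) (facet_mem hF) vF; rewrite e inE.
split=> //.
- by split=> // z q; apply: cover_down.
- move=> z hz; rewrite -(pK _ (cover_facet hz (facet_n0 z hz))) card_pr //.
  exact: facet_mem.
- move=> z hz zd.
  have /card_gt0P[x xz] : 0 < #|z| by rewrite zd subn_gt0; apply: ltn_trans d2.
  have /cover_complexP[zK _] := hz.
  have ez := cover_face_lift hz xz.
  rewrite -(ridge (pr z) zK) ?card_pr //.
  rewrite -[RHS](card_in_imset (f := fun F => lift_face F x)).
    apply: eq_card => q; rewrite [LHS]in_set; apply/andP/imsetP.
      move=> [hq zq]; have xq := subsetP zq x xz.
      exists (pr q); last by apply: cover_face_lift => //; apply: facet_mem.
      by rewrite in_set cover_facet ?facet_n0 //=; apply: imsetS.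
    move=> [F]; rewrite in_set => /andP[hF zF ->].
    have xF : x.1 \in F by apply: (subsetP zF); apply: mem_pr.
    by rewrite lift_facet // {1}ez; split=> //; apply: lift_faceS.
  by move=> F F' _ _ /(congr1 (fun q => pr q)); rewrite !pr_lift.
move=> z hz zd; have [z0|[x xz]] := set_0Vmem z.
  suff -> : link cover_complex z = cover_complex by [].
  apply/setP => q; rewrite z0 inE set0U.
  by rewrite disjoints_subset sub0set /= andbb.
have /cover_complexP[zK _] := hz.
have ez := cover_face_lift hz xz.
have lk q : q \in link cover_complex z -> [/\ q \subset lift_face (pr (z :|: q)) x,
    [disjoint pr z & pr q], pr z :|: pr q \in K & pr q \in K].
  rewrite inE => /and3P[hq dis hzq].
  have xzq : x \in z :|: q by rewrite inE xz.
  have /cover_complexP[zqK _] := hzq; split.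
  - by rewrite -(cover_face_lift hzq xzq) subsetUr.
  - apply/pred0Pn => -[v /= /andP[/imsetP[a az ->] /imsetP[b bq e]]].
    have eab : a = b by apply: (pr_inj hzq) => //; rewrite inE ?az ?bq ?orbT.
    by case/pred0Pn: dis; exists a; rewrite /= az eab bq.
  - by rewrite -imsetU.
  - by have /cover_complexP[] := hq.
pose f w : V * 'I_n := (w, tau x.1 w x.2).
have fK a : [set a] \in link cover_complex z -> a = f a.1 /\ [set a.1] \in link K (pr z).
  move=> ha; have [sub dis zaK aK] := lk _ ha; split.
    by move: sub; rewrite sub1set => /imsetP[w _ ->].
  by rewrite imset_set1 in dis zaK aK; rewrite inE aK dis.
have flink r : r \in link K (pr z) -> r \subset r -> f @: r \in link cover_complex z.
  rewrite inE => /and3P[rK dis zrK] _.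
  have xr : x.1 \in pr z :|: r by rewrite inE mem_pr.
  have e : lift_face (pr z :|: r) x = z :|: f @: r.
    by rewrite {2}ez /lift_face imsetU.
  have hu := lift_face_cover zrK xr; rewrite e in hu.
  rewrite inE hu andbT (cover_down hu (subsetUr _ _)) /=.
  apply/pred0Pn => -[y /= /andP[yz /imsetP[w wr ey]]].
  case/pred0Pn: dis; exists w; rewrite /= wr andbT.
  by rewrite (_ : w = y.1) ?mem_pr // ey.
move=> a b ha hb; have [-> a1] := fK a ha; have [-> b1] := fK b hb.
have lt : #|pr z| <= d - 2 by rewrite card_pr.
have := lK (pr z) zK lt a.1 b.1 a1 b1; move: a.1 b.1 => u v.
move=> cuv; apply: (@connect_ind_prop _ _ (fun w => connect (edge_rel (link cover_complex z)) (f u) (f w)) _ _ _ cuv) => //.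
move=> w w' /andP[ww' hw] cw; apply: connect_trans cw (connect1 _).
apply/andP; split; first by apply: contraNneq ww' => -[->].
by have := flink _ hw (subxx _); rewrite imsetU !imset_set1.
Qed.

Lemma cover_balanced d : balanced d K -> balanced d cover_complex.
Proof.
move=> [kappa kP]; exists (kappa \o fst) => x y /andP[xy hxy]; apply: kP.
have /cover_complexP[xyK _] := hxy.
apply/andP; split.
  apply: contra xy => /eqP e; apply/eqP; apply: (pr_inj hxy) => //.
    exact: set21.
  exact: set22.
by move: xyK; rewrite imsetU !imset_set1.
Qed.

End VoltageCovers.

Section CoverBound.
Local Open Scope ring_scope.

Lemma g2barE (V : finType) (K : {set {set V}}) d : (2 < d)%N -> set0 \in K ->
  g2bar d K = 2 * #|faces K 2|%:Z - 3 * (d%:Z - 1) * #|faces K 1|%:Z + 4 * 'C(d, 2)%:Z.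
Proof.
move=> d2 K0.
have f0 : #|faces K 0| = 1%N.
  rewrite -(cards1 (set0 : {set V})); apply: eq_card => s; rewrite !inE cards_eq0.
  by case: eqP => [->|_]; rewrite ?K0 ?andbF.
rewrite /g2bar /hnum !big_ord_recr !big_ord0 /= f0 !subn0 ?subnn ?bin0 ?binn.
rewrite bin_sub ?(ltnW d2) // (bin_sub (m := 1)) ?(ltnW (ltnW d2)) // bin1.
have -> : 'C(d - 1, d - 2) = (d - 1)%N.
  have -> : (d - 1 = (d - 2).+1)%N by lia.
  by rewrite binSn.
have b4 : (2 * 'C(d, 2) = d * (d - 1))%N by rewrite mul_bin_left bin1 mulnC.
have b4' : 2 * 'C(d, 2)%:Z = d%:Z * (d%:Z - 1).
  by rewrite -[1]/(1%:Z) subzn ?(ltnW (ltnW d2)) // -!PoszM -b4.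
rewrite -subzn ?(ltnW (ltnW d2)) // !expr1 expr2 expr0.
lia.
Qed.

(* Passing to an [n]-sheeted cover multiplies the numbers of vertices and of
   edges by [n], but leaves the constant term of [g2bar] unchanged. *)
Lemma cover_g2bar (V : finType) (K : {set {set V}}) d n (tau : V -> V -> 'I_n -> 'I_n) :
  (2 < d)%N -> (0 < n)%N -> normal_pseudomanifold d K -> balanced d K ->
  flat_voltage K tau -> connected_complex (cover_complex K tau) ->
  0 <= n%:Z * (g2bar d K - 4 * 'C(d, 2)%:Z) + 4 * 'C(d, 2)%:Z.
Proof.
move=> d2 n0 normK balK flat conn.
have scK : simplicial_complex K by case: normK.
have normC := cover_normal scK flat d2 n0 normK conn.
have balC := cover_balanced scK flat balK.
have := balanced_edge_bound d2 normC balC.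
rewrite !(card_cover_faces scK flat) //.
have K0 : set0 \in K by case: scK.
have b4 : (2 * 'C(d, 2) = d * (d - 1))%N by rewrite mul_bin_left bin1 mulnC.
rewrite g2barE // -b4; move: (#|faces K 1|) (#|faces K 2|) ('C(d, 2)) => f0 f1 b.
rewrite -lez_nat !(PoszM, PoszD) -subzn ?(ltnW (ltnW d2)) // => h.
rewrite addrK; move: h; move: d%:Z n%:Z f0%:Z f1%:Z b%:Z => D N F0 F1 B; lia.
Qed.

End CoverBound.

(** * Cyclic covers from the first Betti number *)

Section FirstBetti.
Local Open Scope ring_scope.
Variables (V : finType) (K : {set {set V}}).
Hypothesis scK : simplicial_complex K.
Implicit Types (s e : {set V}) (u v w x : V).

Let dK s t : t \in K -> s \subset t -> s \in K.
Proof. by case: scK => _; apply. Qed.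

Definition position s x := #|[set u in s | (enum_rank u < enum_rank x)%N]|.

Definition coboundary (g : {set V} -> rat) s : rat :=
  \sum_(x in s) (-1) ^+ position s x * g (s :\ x).

Lemma boundary_mxM k (g : {set V} -> rat) :
  boundary_mx K k *m (\col_j g (enum_val j)) = \col_i coboundary g (enum_val i).
Proof.
apply/colP => i; rewrite !mxE /coboundary.
have /andP[sK /eqP sk] : (enum_val i \in K) && (#|enum_val i| == k.+1).
  by have := enum_valP i; rewrite inE.
under eq_bigr do rewrite !mxE /incidence mulr_suml.
rewrite (exchange_big_dep (fun x => x \in enum_val i)) /=; last by move=> j x _ /andP[].
apply: eq_bigr => x xs.
have hx : enum_val i :\ x \in faces K k.
  rewrite inE (dK sK (subsetDl _ _)) /=; have := cardsD1 x (enum_val i).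
  by rewrite xs sk add1n => -[e]; apply/eqP.
rewrite (bigD1 (enum_rank_in hx (enum_val i :\ x))) /=; last first.
  by rewrite xs enum_rankK_in ?eqxx.
rewrite enum_rankK_in // big1 ?addr0 // => j /andP[/andP[_ /eqP e] nj].
by case/eqP: nj; apply: enum_val_inj; rewrite enum_rankK_in.
Qed.

Lemma betti1_cocycle : betti K 1 <> 0%N -> exists g : {set V} -> rat,
  (forall s, s \in faces K 3 -> coboundary g s = 0) /\
  ~ exists f, forall e, e \in faces K 2 -> g e = coboundary f e.
Proof.
rewrite /betti => hb.
have : ~~ (kermx (boundary_mx K 1) <= boundary_mx K 2)%MS.
  by apply/negP => /mxrankS; rewrite -subn_eq0 => /eqP.
rewrite submxE => nz.
set c := cokermx (boundary_mx K 2) in nz.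
have [j nj] : exists j, kermx (boundary_mx K 1) *m col j c != 0.
  apply/existsP; apply: contraNT nz => /existsPn h; apply/eqP/matrixP => i j.
  have := h j; rewrite negbK colE mulmxA -colE => /eqP/colP/(_ i); rewrite !mxE => ->.
  by [].
pose g e := if [pick i | enum_val i == e] is Some i then c i j else 0.
have gE i : g (enum_val i) = c i j.
  rewrite /g; case: pickP => [i' /eqP/enum_val_inj-> //|/(_ i)].
  by rewrite eqxx.
have gc : \col_i g (enum_val i) = col j c.
  by apply/colP => i; rewrite mxE gE [RHS]mxE.
exists g; split.
  move=> s hs; have := boundary_mxM 2 g; rewrite gc.
  rewrite colE mulmxA mulmx_coker mul0mx => /colP/(_ (enum_rank_in hs s)); rewrite !mxE.
  by rewrite enum_rankK_in.
move=> [f hf]; case/eqP: nj.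
have -> : col j c = boundary_mx K 1 *m (\col_k f (enum_val k)).
  by rewrite boundary_mxM -gc; apply/colP => i; rewrite !mxE hf ?enum_valP.
by rewrite mulmxA mulmx_ker mul0mx.
Qed.

Lemma common_denominator (I : finType) (g : I -> rat) :
  exists2 D : rat, D != 0 & exists h : I -> int, forall i, D * g i = (h i)%:~R.
Proof.
exists (\prod_i (denq (g i))%:~R).
  by apply/prodf_neq0 => i _; rewrite intr_eq0 denq_neq0.
exists (fun i => numq (g i) * \prod_(j | j != i) denq (g j)) => i.
rewrite (bigD1 i) //= rmorphM /= numqE rmorph_prod /=.
by rewrite mulrC mulrA.
Qed.

Lemma position_pair u v : (enum_rank u < enum_rank v)%N ->
  position [set u; v] u = 0%N /\ position [set u; v] v = 1%N.
Proof.
move=> uv; split.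
  apply/eqP; rewrite cards_eq0; apply/eqP/setP => x; rewrite !inE.
  apply/negbTE/negP => /andP[/orP[]/eqP-> h]; lia.
rewrite -(cards1 u); apply: eq_card => x; rewrite !inE.
apply/andP/eqP => [[/orP[]/eqP-> //]|->]; first lia.
by rewrite eqxx.
Qed.

Lemma coboundary_pair g u v : (enum_rank u < enum_rank v)%N ->
  coboundary g [set u; v] = g [set v] - g [set u].
Proof.
move=> uv; have [pu pv] := position_pair uv.
have nuv : u != v by apply: contraTneq uv => ->; rewrite ltnn.
rewrite /coboundary big_setU1 ?inE //= big_set1 pu pv expr0 expr1 mul1r mulN1r.
congr (g _ - g _); apply/setP => x; rewrite !inE.
  by case: eqVneq => [->|_] //=; rewrite (negbTE nuv).
by case: (eqVneq x v) => [->|_]; rewrite ?orbF //= eq_sym (negbTE nuv).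
Qed.

Lemma coboundary_triple g u v w : (enum_rank u < enum_rank v)%N ->
  (enum_rank v < enum_rank w)%N ->
  coboundary g [set u; v; w] = g [set v; w] - g [set u; w] + g [set u; v].
Proof.
move=> uv vw.
have nuv : u != v by apply: contraTneq uv => ->; rewrite ltnn.
have nvw : v != w by apply: contraTneq vw => ->; rewrite ltnn.
have nuw : u != w by apply: contraTneq (ltn_trans uv vw) => ->; rewrite ltnn.
rewrite -setUA /coboundary big_setU1 ?inE ?negb_or ?nuv //=.
rewrite big_setU1 ?inE //= big_set1.
have -> : position (u |: [set v; w]) u = 0%N.
  apply/eqP; rewrite cards_eq0; apply/eqP/setP => x; rewrite !inE.
  apply/negbTE/negP => /andP[/or3P[]/eqP-> h]; lia.
have -> : position (u |: [set v; w]) v = 1%N.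
  rewrite -(cards1 u); apply: eq_card => x; rewrite !inE.
  apply/andP/eqP => [[/or3P[]/eqP-> //]|->]; rewrite ?eqxx //; lia.
have -> : position (u |: [set v; w]) w = 2%N.
  have <- : #|[set u; v]| = 2%N by rewrite cards2 nuv.
  apply: eq_card => x; rewrite !inE.
  apply/andP/orP => [[/or3P[]/eqP-> //]|[]/eqP->]; rewrite ?eqxx ?orbT; auto; lia.
rewrite expr0 expr1 sqrrN expr1n !mul1r mulN1r addrA.
congr (g _ - g _ + g _); apply/setP => x; rewrite !inE.
- by case: eqVneq => [->|_] //=; rewrite (negbTE nuv) (negbTE nuw).
- case: (eqVneq x v) => [->|_] //=; first by rewrite eq_sym (negbTE nuv) (negbTE nvw).
- case: (eqVneq x w) => [->|_]; rewrite ?orbF //=.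
  by rewrite ![w == _]eq_sym (negbTE nuw) (negbTE nvw).
Qed.

Lemma betti1_voltage : betti K 1 <> 0%N -> exists o : V -> V -> int,
  [/\ forall u v, o v u = - o u v,
      forall u v w, [set u; v; w] \in K -> o u v + o v w = o u w
    & ~ exists f : V -> int, forall u v, edge_rel K u v -> o u v = f v - f u].
Proof.
move=> /betti1_cocycle[g [gc ng]].
have [D D0 [h hD]] := common_denominator g.
(* Orienting by the enumeration order, with 0 on the diagonal, makes [o] antisymmetric and lets the
   cocycle law hold also when vertices coincide. *)
pose o u v : int := if (enum_rank u < enum_rank v)%N then h [set u; v]
  else if (enum_rank v < enum_rank u)%N then - h [set u; v] else 0.
have oA u v : o v u = - o u v.
  rewrite /o [[set v; u]]setUC; case: ltngtP => // _; by rewrite ?opprK ?oppr0.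
have rk u v : u != v -> (enum_rank u < enum_rank v)%N \/ (enum_rank v < enum_rank u)%N.
  move=> uv; have : enum_rank u != enum_rank v by rewrite (inj_eq enum_rank_inj).
  rewrite -val_eqE /= neq_ltn => /orP; exact.
have oE u v : (enum_rank u < enum_rank v)%N -> o u v = h [set u; v] by rewrite /o => ->.
have o3 u v w : [set u; v; w] \in K -> (enum_rank u < enum_rank v)%N ->
    (enum_rank v < enum_rank w)%N -> o u v + o v w = o u w.
  move=> tK uv vw; have uw := ltn_trans uv vw.
  have nuv : u != v by apply: contraTneq uv => ->; rewrite ltnn.
  have nvw : v != w by apply: contraTneq vw => ->; rewrite ltnn.
  have nuw : u != w by apply: contraTneq uw => ->; rewrite ltnn.
  have ht : [set u; v; w] \in faces K 3.
    by rewrite inE tK setUC cardsU1 cards2 !inE negb_or nuv ![w == _]eq_sym nuw nvw.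
  have := gc _ ht; rewrite coboundary_triple // => /(congr1 ( *%R D)).
  rewrite mulrDr mulrBr mulr0 !hD -rmorphB -rmorphD /= => /eqP.
  by rewrite intr_eq0 !oE // => /eqP; lia.
exists o; split=> //.
  move=> u v w tK.
  have ooo x : o x x = 0 by rewrite /o ltnn.
  have perm a b c : [set a; b; c] = [set u; v; w] -> [set a; b; c] \in K by move=> ->.
  have [<-|/rk uv] := eqVneq u v; first by rewrite ooo add0r.
  have [<-|/rk vw] := eqVneq v w; first by rewrite ooo addr0.
  have [<-|/rk uw] := eqVneq u w; first by rewrite ooo (oA u v) subrr.
  have S1 : [set u; w; v] = [set u; v; w] by rewrite setUAC.
  have S2 : [set v; u; w] = [set u; v; w] by rewrite [[set v; u]]setUC.
  have S3 : [set v; w; u] = [set u; v; w] by rewrite setUC setUA.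
  have S4 : [set w; u; v] = [set u; v; w] by rewrite -setUA setUC.
  have S5 : [set w; v; u] = [set u; v; w] by rewrite setUC [[set w; v]]setUC setUA.
  have T0 := o3 u v w tK; have T1 := o3 _ _ _ (perm _ _ _ S1).
  have T2 := o3 _ _ _ (perm _ _ _ S2); have T3 := o3 _ _ _ (perm _ _ _ S3).
  have T4 := o3 _ _ _ (perm _ _ _ S4); have T5 := o3 _ _ _ (perm _ _ _ S5).
  have A1 := oA u v; have A2 := oA v w; have A3 := oA u w.
  (* Six of the eight sign patterns are linear orders of [u], [v], [w]; the two cyclic ones are
     contradictory. *)
  case: uv => uv; case: vw => vw; case: uw => uw.
  - by rewrite T0.
  - lia.
  - by have := T1 uw vw; lia.
  - by have := T4 uw uv; lia.
  - by have := T2 uv uw; lia.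
  - by have := T3 vw uw; lia.
  - lia.
  - by have := T5 vw uv; lia.
move=> [f hf]; apply: ng.
(* An integral potential for [o], divided by the common denominator, would be a rational potential
   for [g]. *)
exists (fun s => if [pick x | s == [set x]] is Some x then (f x)%:~R / D else 0).
have pk x : [pick x' | [set x] == [set x']] = Some x.
  case: pickP => [x' /eqP/set1_inj-> //|/(_ x)]; by rewrite eqxx.
move=> e; rewrite inE => /andP[eK /cards2P[u [v [uv ee]]]].
wlog lt : u v uv ee / (enum_rank u < enum_rank v)%N.
  move=> W; case: (rk _ _ uv) => lt; first exact: (W u v).
  by apply: (W v u) => //; rewrite 1?eq_sym // setUC.
rewrite ee coboundary_pair // !pk -mulrBl -rmorphB /= -(hf u v); last first.
  by rewrite /edge_rel uv -ee.
by rewrite oE // -hD mulrC mulKf.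
Qed.

Section Walks.
Variable o : V -> V -> int.
Hypothesis oA : forall u v, o v u = - o u v.
Hypothesis oC : forall u v w, [set u; v; w] \in K -> o u v + o v w = o u w.
Hypothesis connK : connected_complex K.

Inductive walk u : V -> int -> Prop :=
| walk0 : walk u u 0
| walkS v w k : walk u v k -> edge_rel K v w -> walk u w (k + o v w).

Lemma edge_rel_sym u v : edge_rel K u v = edge_rel K v u.
Proof. by rewrite /edge_rel eq_sym setUC. Qed.

Lemma walk_trans u v w k l : walk u v k -> walk v w l -> walk u w (k + l).
Proof.
move=> uv; elim=> [|x y m _ ih xy]; first by rewrite addr0.
by rewrite addrA; apply: walkS.
Qed.

Lemma walk_rev u v k : walk u v k -> walk v u (- k).
Proof.
elim=> [|x y m _ ih xy]; first by rewrite oppr0; apply: walk0.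
rewrite opprD addrC -oA -[o y x]add0r; apply: walk_trans ih.
by apply: walkS (walk0 y) _; rewrite edge_rel_sym.
Qed.

Lemma walk_exists u v : [set u] \in K -> [set v] \in K -> exists k, walk u v k.
Proof.
move=> uK vK; apply: (connect_ind_prop (B := fun v => exists k, walk u v k) _ (connK uK vK)); last by exists 0; apply: walk0.
by move=> x y xy [k hk]; exists (k + o x y); apply: walkS.
Qed.

Lemma walk_mul u m k : walk u u m -> walk u u (m *+ k).
Proof.
move=> h; elim: k => [|k ih]; first by rewrite mulr0n; apply: walk0.
by rewrite mulrS; apply: walk_trans ih.
Qed.

(* If every closed walk at the base point had sum zero, the sums along walks
   from the base point would be a potential for [o]. *)
Lemma closed_walk_exists : ~ (exists f, forall u v, edge_rel K u v -> o u v = f v - f u) ->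
  exists v0, [set v0] \in K /\ exists2 m, 0 < m & walk v0 v0 m.
Proof.
move=> nf; have [v0 v0K] : exists v0, [set v0] \in K.
  apply: contrapT => h; apply: nf; exists (fun=> 0) => u v /andP[_ uvK].
  by case: h; exists u; apply: dK uvK _; rewrite sub1set set21.
exists v0; split=> //; apply: contrapT => h.
have zero m : walk v0 v0 m -> m = 0.
  move=> hm; have [lt|gt|//] := ltrgtP m 0.
    by case: h; exists (- m); [rewrite oppr_gt0 | apply: walk_rev].
  by case: h; exists m.
have [f hf] : exists f : V -> int, forall v, [set v] \in K -> walk v0 v (f v).
  have F v : {k | [set v] \in K -> walk v0 v k}.
    have [vK|nvK] := boolP ([set v] \in K); last by exists 0.
    by have /cid[k hk] := walk_exists v0K vK; exists k.
  by exists (fun v => sval (F v)) => v; case: (F v).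
apply: nf; exists f => u v uv.
have [uK vK] : [set u] \in K /\ [set v] \in K.
  by case/andP: uv => _ uvK; split; apply: dK uvK _; rewrite sub1set ?set21 ?set22.
have := zero _ (walk_trans (walkS (hf u uK) uv) (walk_rev (hf v vK))).
by move=> e; lia.
Qed.

Definition cyclic_voltage n u v (i : 'I_n.+1) : 'I_n.+1 := i + inZp 1 *~ o u v.

Lemma cyclic_voltage_flat n : flat_voltage K (@cyclic_voltage n).
Proof.
split=> [u i uK|u v w i tK]; rewrite /cyclic_voltage.
  have := oC (u := u) (v := u) (w := u); rewrite !setUid => /(_ uK) e.
  have -> : o u u = 0 by lia.
  by rewrite mulr0z addr0.
by rewrite -(oC tK) mulrzDr addrA.
Qed.

(** The loop shifts the fibre over [v0] by [m], a unit modulo [N * m + 1], so its powers act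
    transitively on that fibre. Walks to and from [v0] do the rest. *)
Lemma cyclic_cover_connected N m v0 : [set v0] \in K -> (0 < m)%N -> walk v0 v0 m%:Z ->
  connected_complex (cover_complex K (@cyclic_voltage (N * m))).
Proof.
move=> v0K m0 loop; set n := (N * m)%N.
have flat := cyclic_voltage_flat n.
pose g : 'I_n.+1 := inZp 1.
have step u v k (i : 'I_n.+1) : walk u v k ->
    connect (edge_rel (cover_complex K (@cyclic_voltage n))) (u, i) (v, i + g *~ k).
  elim=> [|x y l _ ih xy]; first by rewrite mulr0z addr0 connect0.
  apply: connect_trans ih (connect1 _); rewrite mulrzDr addrA.
  case/andP: xy => nxy xyK; apply/andP; split; first by apply: contraNneq nxy => -[->].
  have hx : (x, i + g *~ l).1 \in [set x; y] by rewrite set21.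
  have := lift_face_cover scK flat xyK hx.
  rewrite /lift_face imsetU !imset_set1 /=.
  have -> : cyclic_voltage x x (i + g *~ l) = i + g *~ l.
    by case: flat => -> //; apply: dK xyK _; rewrite sub1set set21.
  by [].
have gen (a : 'I_n.+1) : g *+ a = a.
  by apply: val_inj; rewrite Zp_mulrn /= modnMml mul1n modn_small.
have gn : g *+ n.+1 = 0 by apply: val_inj; rewrite Zp_mulrn /= modnMml mul1n modnn.
move=> [u i] [v j] hu hv.
have inK (a : V) (b : 'I_n.+1) : [set (a, b)] \in cover_complex K (@cyclic_voltage n) -> [set a] \in K.
  by case/cover_complexP; rewrite imset_set1.
have uK := inK _ _ hu; have vK := inK _ _ hv.
have [k1 w1] := walk_exists uK v0K; have [k2 w2] := walk_exists v0K vK.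
pose a : 'I_n.+1 := j - (i + g *~ (k1 + k2)).
(* The factor [n.+1 - N] inverts [m] modulo [n.+1], since m (N m + 1 - N) = (N m + 1) (m - 1) +
   1. *)
pose l := (a * (n.+1 - N))%N.
have w := walk_trans (walk_trans w1 (walk_mul l loop)) w2.
have := step _ _ _ i w.
suff -> : i + g *~ (k1 + m%:Z *+ l + k2) = j by [].
have e : g *~ (m%:Z *+ l) = a.
  have el : (m * l = a * (n.+1 * m.-1 + 1))%N.
    rewrite /l mulnCA; congr (_ * _)%N; rewrite mulnBr /n.
    case: (m) m0 => // m' _; rewrite /= !mulnS; lia.
  rewrite -mulr_natr natz -PoszM el -pmulrn mulnDr muln1 mulrnDr gen.
  by rewrite mulnCA mulrnA gn mul0rn add0r.
by rewrite addrAC mulrzDr e addrA /a subrKC.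
Qed.

End Walks.

End FirstBetti.

(** * Topological coverings *)

From mathcomp Require Import all_classical all_reals all_analysis.
Import numFieldNormedType.Exports.
From mathcomp Require Import lra.

(** * Compactness of the realization *)

Section Realization.
Local Open Scope ring_scope.
Local Open Scope classical_set_scope.
Variables (R : realType) (V : finType) (K : {set {set V}}).
Hypothesis scK : simplicial_complex K.

Definition close (e : R) (x y : V -> R) := forall v, `|x v - y v| < e.

Lemma ptws_near_close (x : {ptws V -> R}) e : 0 < e ->
  \forall y \near x, close e x y.
Proof.
move=> e0.
have FF : Filter (nbhs x) by exact: nbhs_filter.
have := @filter_forall {ptws V -> R} V (fun v => [set y : {ptws V -> R} | `|x v - y v| < e]) (nbhs x) FF.
apply.
move=> v.
have h : nbhs (proj v x) [set r : R | `|x v - r| < e] by exact: (@nbhsx_ballx _ _ (x v) e e0).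
exact: (@proj_continuous V (fun=> R) v x _ h).
Qed.

Lemma ptws_nbhs_close (x : {ptws V -> R}) W : nbhs x W ->
  exists2 e, 0 < e & forall y, close e x y -> W y.
Proof.
pose G : set_system (V -> R) := filter_from [set e : R | 0 < e] (fun e => [set y | close e x y]).
have FG : Filter G.
  apply: filter_from_filter; first by exists 1 => /=; exact: ltr01.
  move=> e f /= e0 f0; exists (Num.min e f); first by rewrite /= lt_min e0 f0.
  by move=> y /= h; split=> v; have := h v; rewrite lt_min => /andP[].
have Gx : G --> x.
  apply/cvg_sup => v A [B [hB xB sA]]; case: hB xB sA => O oO <- xO sA.
  have /nbhs_ballP[e e0 he] : nbhs (x v) O by apply: open_nbhs_nbhs.
  by exists e => //= y /(_ v) h; apply: sA; apply: he.
by move=> /Gx[e e0 h]; exists e.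
Qed.

Lemma realization_nbhsP (a : realization R K) (W : set (realization R K)) :
  nbhs a W <-> exists2 e : R, 0 < e & forall b : realization R K, close e (val a) (val b) -> W b.
Proof.
split.
  move=> [B [hB aB sW]]; case: hB aB sW => O oO <- aO sW.
  have [e e0 h] := ptws_nbhs_close (open_nbhs_nbhs (conj oO aO)).
  by exists e => // b cb; apply: sW; apply: h.
move=> [e e0 h].
have := ptws_near_close (val a : {ptws V -> R}) e0; rewrite nbhsE => -[W0 [oW0 W0a] sW0].
have oB : open (set_val @^-1` W0 : set (realization R K)) by exists W0.
have aB : (set_val @^-1` W0 : set (realization R K)) a by [].
exists (set_val @^-1` W0) => //.
by move=> b /sW0; apply: h.
Qed.

Lemma realization_valP (a : realization R K) : realization_set K (val a).
Proof. by case: a => x /= /set_mem. Qed.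

(** A closed subset of a cube: each way of violating the conditions persists under small changes.
    For the support this holds because nonzero coordinates stay nonzero and faces are closed under
    subsets. *)
Lemma realization_compact : compact (@realization_set R V K).
Proof.
apply: (@subclosed_compact _ _ [set x : {ptws V -> R} | forall v, `[0, 1]%classic (x v)]).
- rewrite -[realization_set K]setCK; apply: open_closedC.
  rewrite openE => x nx; rewrite /interior.
  have [[v xv]|nneg] := pselect (exists v, x v < 0).
    have e0 : 0 < - x v by rewrite oppr_gt0.
    near=> y; have cy : close (- x v) x y by near: y; exact: ptws_near_close.
    move=> [h _ _]; have := h v; have := cy v; rewrite ltr_norml; lra.
  have {}nneg v : 0 <= x v by rewrite leNgt; apply/negP => h; apply: nneg; exists v.
  have [s1|ns1] := eqVneq (\sum_v x v) 1; last first.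
    (* So small that |V| changes of size [e] cannot bring the sum to 1. *)
    pose e := `|1 - \sum_v x v| / (#|V|%:R + 1).
    have V0 : 0 < #|V|%:R + 1 :> R by rewrite ltr_wpDl.
    have e0 : 0 < e by rewrite divr_gt0 // normr_gt0 subr_eq0 eq_sym.
    near=> y; have cy : close e x y by near: y; exact: ptws_near_close.
    move=> [_ sy _]; have : `|1 - \sum_v x v| <= #|V|%:R * e.
      have -> : #|V|%:R * e = \sum_(v : V) e by rewrite sumr_const mulr_natl.
      rewrite -sy -sumrB; apply: le_trans (ler_norm_sum _ _ _) _.
      by apply: ler_sum => v _; rewrite distrC ltW.
    rewrite /e mulrCA ler_pMr; last by rewrite normr_gt0 subr_eq0 eq_sym.
    by rewrite ler_pdivlMr // mul1r; lra.
  have nK : (finset (fun v => x v != 0)) \notin K.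
    by apply/negP => h; apply: nx; split.
  near=> y => -[_ _ hy].
  have sub : (finset (fun v => x v != 0) \subset finset (fun v => y v != 0))%SET.
    apply/fintype.subsetP => v; rewrite !inE => xv.
    have : forall v, x v != 0 -> y v != 0.
      near: y; apply: filter_forall => {}v; case: (eqVneq (x v) 0) => xv0.
        by apply: nearW.
      have e0 : 0 < `|x v| by rewrite normr_gt0.
      near=> y => _; have cy : close `|x v| x y by near: y; exact: ptws_near_close.
      by apply: contraTneq (cy v) => ->; rewrite subr0 ltxx.
    by apply.
  by case: scK => _ /(_ _ _ hy sub); rewrite (negbTE nK).
- by apply: (@tychonoff V (fun=> R) (fun=> `[0, 1]%classic)) => v; exact: segment_compact.
- move=> x [x0 x1 _] v /=; rewrite in_itv /= x0 -x1 (bigD1 v) //=.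
  by rewrite lerDl; apply: sumr_ge0 => w _.
Unshelve. all: by end_near. Qed.

(** Compactness in its near-covering form: around each point, every small [lam] works for all
    neighbouring centres, so one [lam] works everywhere. Half of the radius [e] is spent on moving
    the centre. *)
Lemma lebesgue_number (P : set (realization R K) -> Prop) :
  (forall a, exists U, [/\ open U, U a & P U]) ->
  exists2 lam : R, 0 < lam & forall a : realization R K, exists U,
    [/\ open U, P U & forall b : realization R K, close lam (val a) (val b) -> U b].
Proof.
move=> hP.
pose Q (lam : R) (x : {ptws V -> R}) := forall a : realization R K, val a = x ->
  exists U, [/\ open U, P U & forall b : realization R K, close lam (val a) (val b) -> U b].
have /compact_near_coveringP/near_covering_withinP cov := realization_compact.
have : \forall lam \near 0^'+, @realization_set R V K `<=` Q lam.
  apply: cov => x hx.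
  pose a : realization R K := exist _ x (mem_set hx).
  have [U [oU Ua PU]] := hP a.
  have /realization_nbhsP[e e0 he] : nbhs a U by apply: open_nbhs_nbhs.
  have e2 : 0 < e / 2 by rewrite divr_gt0.
  near=> y lam => hy b eb; exists U; split=> // c cbc; apply: he => v /=.
  have h1 : close (e / 2) x y by near: y; exact: ptws_near_close.
  have h2 : lam < e / 2 by near: lam; exact: nbhs_right_lt.
  have := cbc v; rewrite eb; have := h1 v.
  have -> : x v - (val c) v = (x v - y v) + (y v - val c v) by rewrite addrA subrK.
  move=> h3 h4; apply: le_lt_trans (ler_normD _ _) _; rewrite (splitr e); exact: ltrD h3 (lt_trans h4 h2).
move=> h; near ((0 : R)^'+) => lam.
have l0 : 0 < lam by near: lam; exact: nbhs_right_gt.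
exists lam => // a.
have hl : @realization_set R V K `<=` Q lam by near: lam.
exact: (hl _ (realization_valP a)).
Unshelve. all: by end_near. Qed.

End Realization.

(** * Transport of points along segments *)

Section Lifting.
Local Open Scope ring_scope.
Local Open Scope classical_set_scope.

(** The other sheets have an open union, so [D] meets [A] in a set that is both open and closed in
    [D]. *)
Lemma connected_sheet (E : topologicalType) (S : set (set E)) (A D : set E) :
  (forall A, S A -> open A) ->
  (forall A A', S A -> S A' -> A `&` A' !=set0 -> A = A') ->
  connected D -> D `<=` \bigcup_(A in S) A -> S A -> D `&` A !=set0 -> D `<=` A.
Proof.
move=> oS dS cD DS SA DA0; suff <- : D `&` A = D by move=> x [].
apply: cD => //; first by exists A => //; apply: oS.
exists (~` \bigcup_(A' in [set A' | S A' /\ A' <> A]) A').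
  by apply: open_closedC; apply: bigcup_open => A' [/oS].
apply/seteqP; split=> x [Dx].
  by move=> Ax; split=> // -[A' [SA' nA'] A'x]; apply: nA'; apply: dS => //; exists x.
move=> h; split=> //; have [A' SA' A'x] := DS x Dx.
have [<-//|nA] := pselect (A' = A).
by case: h; exists A'.
Qed.

Lemma convex_lt (R : realDomainType) (r a b e : R) : 0 <= r <= 1 -> a < e -> b < e ->
  a + r * (b - a) < e.
Proof.
move=> /andP[r0 r1] ae be.
have [h|h] := leP a b; first by apply: le_lt_trans be; nra.
by apply: le_lt_trans ae; nra.
Qed.

Section Transport.
Variables (R : realType) (V : finType) (K : {set {set V}}).
Hypothesis scK : simplicial_complex K.
Notation B := (realization R K).
Implicit Types (x y z : B) (s : {set V}).

Definition in_face s x := forall v, v \notin s -> val x v = 0.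

Definition seg_fun x y (r : R) : {ptws V -> R} := fun v => val x v + r * (val y v - val x v).

(** Total, with default [x]; for [x] and [y] in a common face and [r] in the unit interval the
    default is never taken. *)
Definition seg x y (r : R) : B :=
  if pselect (realization_set K (seg_fun x y r)) is left h
  then exist _ (seg_fun x y r) (mem_set h) else x.

Lemma coord_ge0 x v : 0 <= val x v.
Proof. by have [] := realization_valP x. Qed.

Lemma coord_le1 x v : val x v <= 1.
Proof.
have [x0 <- _] := realization_valP x; rewrite (bigD1 v) //= lerDl.
by apply: sumr_ge0 => w _; apply: x0.
Qed.

Lemma val_seg s x y r : s \in K -> in_face s x -> in_face s y -> 0 <= r <= 1 ->
  val (seg x y r) = seg_fun x y r.
Proof.
move=> sK sx sy /andP[r0 r1]; rewrite /seg; case: pselect => // -[]; split.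
- move=> v; rewrite /seg_fun; have := coord_ge0 x v; have := coord_ge0 y v; nra.
- rewrite /seg_fun big_split /= -mulr_sumr sumrB.
  have [_ -> _] := realization_valP x; have [_ -> _] := realization_valP y.
  by rewrite subrr mulr0 addr0.
- case: scK => _; apply; first exact: sK.
  apply/fintype.subsetP => v; rewrite !inE /seg_fun; apply: contraNT => vs.
  by rewrite sx // sy // subrr mulr0 addr0.
Qed.

Lemma seg0 x y : seg x y 0 = x.
Proof.
rewrite /seg; case: pselect => // h; apply: val_inj => /=.
by apply/funext => v; rewrite /seg_fun mul0r addr0.
Qed.

Lemma seg1 s x y : s \in K -> in_face s x -> in_face s y -> seg x y 1 = y.
Proof.
move=> sK sx sy; apply: val_inj; rewrite (val_seg sK sx sy) ?ler01 ?lexx //.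
by apply/funext => v; rewrite /seg_fun mul1r addrC subrK.
Qed.

Lemma segxx x r : seg x x r = x.
Proof.
rewrite /seg; case: pselect => // h; apply: val_inj => /=.
by apply/funext => v; rewrite /seg_fun subrr mulr0 addr0.
Qed.

Lemma in_face_seg s x y r : s \in K -> in_face s x -> in_face s y -> 0 <= r <= 1 ->
  in_face s (seg x y r).
Proof.
move=> sK sx sy hr v vs; rewrite (val_seg sK) // /seg_fun sx // sy //.
by rewrite subrr mulr0 addr0.
Qed.

Lemma close_seg s x y z r (e : R) : s \in K -> in_face s x -> in_face s y ->
  0 <= r <= 1 -> close e (val z) (val x) -> close e (val z) (val y) ->
  close e (val z) (val (seg x y r)).
Proof.
move=> sK sx sy hr cx cy v; rewrite (val_seg sK sx sy hr) /seg_fun.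
have := cx v; have := cy v; rewrite !ltr_norml => /andP[a b] /andP[c d].
have h1 := convex_lt hr d b.
have h2 := @convex_lt R r (val x v - val z v) (val y v - val z v) e hr.
apply/andP; split; last by move: h1; lra.
have {}h2 := h2 ltac:(lra) ltac:(lra); lra.
Qed.

Lemma close_seg_seg s x y z r (e : R) : s \in K -> in_face s x -> in_face s y ->
  in_face s z -> 0 <= r <= 1 -> 0 < e -> close e (val y) (val z) ->
  close e (val (seg x y r)) (val (seg x z r)).
Proof.
move=> sK sx sy sz hr e0 c v; rewrite !(val_seg sK) // /seg_fun.
have := c v; rewrite !ltr_norml => /andP[a b].
have h1 := convex_lt hr e0 b.
have h2 := @convex_lt R r 0 (val z v - val y v) e hr e0.
apply/andP; split; last by move: h1; lra.
have {}h2 := h2 ltac:(lra); lra.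
Qed.

Lemma close_seg_step s x y r r' (e : R) : s \in K -> in_face s x -> in_face s y ->
  0 <= r <= 1 -> 0 <= r' <= 1 -> `|r - r'| < e ->
  close e (val (seg x y r)) (val (seg x y r')).
Proof.
move=> sK sx sy hr hr' c v; rewrite !(val_seg sK) // /seg_fun.
have -> : val x v + r * (val y v - val x v) - (val x v + r' * (val y v - val x v)) =
    (r - r') * (val y v - val x v) by rewrite mulrBl opprD addrACA subrr add0r.
rewrite normrM; apply: le_lt_trans c; rewrite ler_piMr //.
have := coord_ge0 x v; have := coord_ge0 y v; have := coord_le1 x v; have := coord_le1 y v.
by move=> *; rewrite ler_norml; lra.
Qed.

Lemma seg_continuous s x y : s \in K -> in_face s x -> in_face s y ->
  {within `[0, 1], continuous (seg x y)}.
Proof.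
move=> sK sx sy; apply/subspace_continuousP => r hr W.
move=> /realization_nbhsP[e e0 he].
rewrite /= in_itv /= in hr.
have h : \forall r' \near r, `|r - r'| < e by exact: (@nbhsx_ballx _ _ r e e0).
apply: filterS h => r' h'; rewrite /= in_itv /= => hr'.
by apply: he; apply: (close_seg_step sK).
Qed.

Section Covering.
Variables (E : topologicalType) (p : E -> B).
Hypothesis covp : covering_map p.

(** [g] is the local inverse of [p] through [e], on an evenly covered [U] containing the [lam]-cube
    about [p e]. The whole family [S] of sheets is kept, since a lift is shown to stay in [A] by its
    disjointness from the others. *)
Definition chart (lam : R) e (A : set E) (g : B -> E) :=
  exists (U : set B) (S : set (set E)),
  [/\ forall y, close lam (val (p e)) (val y) -> U y,
      open U, (forall A, S A -> open A) /\
      (forall A A', S A -> S A' -> A `&` A' !=set0 -> A = A'),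
      \bigcup_(A in S) A = p @^-1` U /\ S A &
      [/\ A e, forall e, A e -> g (p e) = e, forall y, U y -> A (g y) /\ p (g y) = y
        & {in U, continuous g}]].

Lemma chart_exists : exists2 lam : R, 0 < lam & forall e, exists Ag, chart lam e Ag.1 Ag.2.
Proof.
case: covp => _ hcov.
have [|lam l0 hl] := @lebesgue_number R V K scK (evenly_covered p).
  by move=> a; have [U [oU Ua evU]] := hcov a; exists U.
exists lam => // e; have [U [oU [S [oS dS uS hS]] hU]] := hl (p e).
have [A SA Ae] : (\bigcup_(A in S) A) e.
  by rewrite uS /=; apply: hU => v; rewrite subrr normr0.
have [g [pA gU [gK Kg] _ cg]] := hS A SA.
exists (A, g); exists U, S; split=> //; split=> //.
  by move=> y Uy; split; [exact: gU | exact: Kg].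
by rewrite -continuous_open_subspace.
Qed.

Variables (lam : R) (sheet : E -> set E) (l : E -> B -> E).
Hypothesis lam0 : 0 < lam.
Hypothesis chartP : forall e, chart lam e (sheet e) (l e).

Lemma l_self e : l e (p e) = e.
Proof. by have [U [S [_ _ _ _ [Ae gp _ _]]]] := chartP e; apply: gp. Qed.

Lemma p_l e y : close lam (val (p e)) (val y) -> p (l e y) = y.
Proof.
by have [U [S [hU _ _ _ [_ _ pg _]]]] := chartP e => /hU/pg[].
Qed.

Lemma l_near e : \forall e' \near e, e' = l e (p e').
Proof.
have [U [S [_ _ [oS _] [_ SA] [Ae gp _ _]]]] := chartP e.
have := open_nbhs_nbhs (conj (oS _ SA) Ae).
by apply: filterS => e' /gp.
Qed.

(* The lift of the segment from [y] to [z] given by the chart at [l e y] starts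
   in the sheet of the chart at [e], so by connectedness it stays in it. *)
Lemma l_flat s e y z : s \in K -> in_face s y -> in_face s z ->
  close lam (val (p e)) (val y) -> close lam (val (p e)) (val z) ->
  close lam (val y) (val z) -> l (l e y) z = l e z.
Proof.
move=> sK sy sz cy cz cyz.
have [U [S [hU oU [oS dS] [uS SA] [Ae gp pg cg]]]] := chartP e.
have [U' [S' [hU' oU' [oS' dS'] [uS' SA'] [Ae' gp' pg' cg']]]] := chartP (l e y).
rewrite p_l // in hU'.
set A := sheet e in SA Ae gp pg cg.
pose h := l (l e y) \o seg y z.
have inU r : 0 <= r <= 1 -> U (seg y z r).
  by move=> hr; apply: hU; apply: (close_seg sK).
have cyy : close lam (val y) (val y) by move=> v; rewrite subrr normr0.
have inU' r : 0 <= r <= 1 -> U' (seg y z r).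
  by move=> hr; apply: hU'; apply: (close_seg sK).
have ch : {within `[0, 1], continuous h}.
  apply: within_continuous_comp (seg_continuous sK sy sz).
  move=> b /set_mem[r]; rewrite /= in_itv /= => hr <-.
  by apply: cg'; apply/mem_set; apply: inU'.
have cD := connected_continuous_connected (@segment_connected R 0 1) ch.
have h0 : h 0 = l e y.
  by rewrite /h /= seg0 -{2}(p_l cy) l_self.
have sub : h @` `[0, 1] `<=` A.
  apply: (connected_sheet oS dS cD) => //.
    move=> b [r]; rewrite /= in_itv /= => hr <-; rewrite uS /=.
    by have [_ ->] := pg' _ (inU' r hr); apply: inU.
  exists (l e y); split; last by have [] := pg _ (hU _ cy).
  by exists 0 => //=; rewrite in_itv /= lexx ler01.
have A1 : A (h 1) by apply: sub; exists 1 => //=; rewrite in_itv /= lexx ler01.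
have h1 : h 1 = l (l e y) z by rewrite /h /= (seg1 sK).
rewrite -h1 -[LHS](gp _ A1) h1.
by rewrite p_l // p_l.
Qed.

Variable N : nat.
Hypothesis N0 : (0 < N)%N.
Hypothesis Nlam : N%:R^-1 < lam / 2.

Definition frac (k : nat) : R := k%:R / N%:R.

(** The lift of the segment from [p e] to [y], continued at each step by the chart at the point just
    reached. Steps shorter than [lam / 2] leave as much room for a comparison with a neighbouring
    segment. *)
Fixpoint trk e y (k : nat) : E :=
  if k is k'.+1 then l (trk e y k') (seg (p e) y (frac k)) else e.

Definition tr e y := trk e y N.

Lemma frac01 k : (k <= N)%N -> 0 <= frac k <= 1.
Proof.
move=> kN; have N0' : 0 < N%:R :> R by rewrite ltr0n.
by rewrite divr_ge0 //= ler_pdivrMr // mul1r ler_nat.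
Qed.

Lemma frac_step k : `|frac k - frac k.+1| < lam / 2.
Proof.
rewrite /frac -mulrBl -(natr1 k) opprD addrA subrr add0r mulN1r normrN.
by rewrite ger0_norm // invr_ge0.
Qed.

Lemma half_lam : 0 < lam / 2 < lam.
Proof. by have := lam0; lra. Qed.

Lemma close_half x y : close (lam / 2) (val x) (val y) -> close lam (val x) (val y).
Proof. by move=> c v; apply: lt_trans (c v) _; case/andP: half_lam. Qed.

Lemma close_add x y z : close (lam / 2) (val x) (val y) ->
  close (lam / 2) (val y) (val z) -> close lam (val x) (val z).
Proof.
move=> c1 c2 v.
have -> : val x v - val z v = (val x v - val y v) + (val y v - val z v) by rewrite addrA subrK.
by apply: le_lt_trans (ler_normD _ _) _; rewrite (splitr lam); apply: ltrD.
Qed.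

Section Face.
Variable s : {set V}.
Hypothesis sK : s \in K.

Lemma p_trk e y k : in_face s (p e) -> in_face s y -> (k <= N)%N ->
  p (trk e y k) = seg (p e) y (frac k).
Proof.
move=> se sy; elim: k => [|k ih] kN /=; first by rewrite /frac mul0r seg0.
rewrite p_l // ih ?(ltnW kN) //; apply: close_half; apply: (close_seg_step sK) => //.
- by apply: frac01; apply: ltnW.
- exact: frac01.
- exact: frac_step.
Qed.

Lemma fracN : frac N = 1.
Proof. by rewrite /frac divff // pnatr_eq0 -lt0n. Qed.

Lemma p_tr e y : in_face s (p e) -> in_face s y -> p (tr e y) = y.
Proof. by move=> se sy; rewrite p_trk // fracN (seg1 sK). Qed.

Lemma tr_self e : tr e (p e) = e.
Proof.
rewrite /tr; elim: N => //= k ih; by rewrite ih segxx l_self.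
Qed.

(** The lifts of the segments to [y] and to [z] remain related by a chart at every step: one step
    along plus the gap across stays below [lam], so the two ways round each small quadrilateral
    agree by [l_flat]. *)
Lemma tr_near e y z : in_face s (p e) -> in_face s y -> in_face s z ->
  close (lam / 2) (val y) (val z) -> tr e z = l (tr e y) z.
Proof.
move=> se sy sz c.
have [e0 _] := andP half_lam.
suff main k : (k <= N)%N -> trk e z k = l (trk e y k) (seg (p e) z (frac k)).
  by rewrite /tr main // fracN (seg1 sK).
elim: k => [|k ih] kN; first by rewrite /= /frac mul0r seg0 l_self.
have kN' := ltnW kN.
have fk := frac01 kN'; have fk1 := frac01 kN.
have sk (w : B) j : in_face s w -> (j <= N)%N -> in_face s (seg (p e) w (frac j)).
  by move=> sw jN; apply: in_face_seg => //; apply: frac01.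
have cyz j : (j <= N)%N ->
    close (lam / 2) (val (seg (p e) y (frac j))) (val (seg (p e) z (frac j))).
  by move=> jN; apply: (close_seg_seg sK) => //; apply: frac01.
have cst (w : B) : in_face s w ->
    close (lam / 2) (val (seg (p e) w (frac k))) (val (seg (p e) w (frac k.+1))).
  by move=> sw; apply: (close_seg_step sK) => //; apply: frac_step.
have py := p_trk se sy kN'.
rewrite [LHS]/= ih // [in RHS]/=.
rewrite (@l_flat s) ?py //; first rewrite (@l_flat s) ?py //.
- exact: sk.
- exact: sk.
- exact: close_half (cst y sy).
- exact: close_add (cst y sy) (cyz _ kN).
- exact: close_half (cyz _ kN).
- exact: sk.
- exact: sk.
- exact: close_half (cyz _ kN').
- exact: close_add (cyz _ kN') (cst z sz).
- exact: close_half (cst z sz).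
Qed.

(** The holonomy around a triangle inside a face is trivial: as the endpoint moves from [y] to [z],
    [tr_near] shows that the direct transport from [e] follows the lift of this movement step by
    step. *)
Lemma tr_flat e y z : in_face s (p e) -> in_face s y -> in_face s z ->
  tr (tr e y) z = tr e z.
Proof.
move=> se sy sz.
have pey := p_tr se sy.
suff main k : (k <= N)%N -> trk (tr e y) z k = tr e (seg y z (frac k)).
  by rewrite {1}/tr main // fracN (seg1 sK).
elim: k => [|k ih] kN; first by rewrite /= /frac mul0r seg0.
rewrite /= ih ?(ltnW kN) // pey; apply/esym/tr_near => //.
- by apply: in_face_seg => //; apply: frac01; apply: ltnW.
- by apply: in_face_seg => //; apply: frac01.
- by apply: (close_seg_step sK) => //; [apply: frac01; apply: ltnW | apply: frac01 | apply: frac_step].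
Qed.

End Face.
End Covering.
End Transport.

Lemma fibre_enum (T : Type) (A : set T) n : (0 < n)%N -> (A #= `I_n)%card ->
  exists (idx : T -> 'I_n) (pnt : 'I_n -> T), [/\ forall i, A (pnt i),
    forall i, idx (pnt i) = i & forall a, A a -> pnt (idx a) = a].
Proof.
move=> n0 /card_set_bijP[f [fA finj fsurj]].
have F (i : 'I_n) : exists a, A a /\ f a = i.
  by have [a Aa fa] := fsurj i (ltn_ord i); exists a.
have [pnt hp] := choice F.
pose idx a := insubd (Ordinal n0) (f a) : 'I_n.
have idxE a : A a -> val (idx a) = f a.
  by move=> Aa; rewrite val_insubd; have := fA a Aa => /= ->.
exists idx, pnt; split.
- by move=> i; case: (hp i).
- by move=> i; apply: val_inj; have [Ai fi] := hp i; rewrite idxE.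
- move=> a Aa; have [Ai fi] := hp (idx a); apply: finj; rewrite ?inE //.
  by rewrite fi idxE.
Qed.

(** * The voltage of a topological covering *)

Section CoveringVoltage.
Variables (R : realType) (V : finType) (K : {set {set V}}).
Hypothesis scK : simplicial_complex K.
Notation B := (realization R K).

Lemma vertex_point v : ([set v] \in K)%SET -> exists x : B, forall w, val x w = (w == v)%:R.
Proof.
move=> vK; have h : realization_set K (fun w => (w == v)%:R : R).
  split.
  - by move=> w; rewrite ler0n.
  - rewrite (bigD1 v) //= eqxx big1 ?addr0 // => w /negbTE->.
    by [].
  - rewrite (_ : finset _ = [set v]%SET) //; apply/setP => w; rewrite !inE.
    by rewrite pnatr_eq0; case: (w == v).
by exists (exist (fun x => x \in realization_set K) _ (mem_set h)) => w.
Qed.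

Definition supp (x : B) : {set V} := finset (fun v => val x v != 0).

Lemma supp_mem x : supp x \in K.
Proof. by have [_ _] := realization_valP x. Qed.

Lemma in_face_supp x : in_face (supp x) x.
Proof. by move=> v; rewrite inE negbK => /eqP. Qed.

Lemma in_faceS (s : {set V}) (x : B) : (supp x \subset s)%SET -> in_face s x.
Proof.
move=> /fintype.subsetP sub v vs; apply/eqP; apply: contraNT vs => nz.
by apply: sub; rewrite inE.
Qed.

Lemma supp_neq0 x : exists v, v \in supp x.
Proof.
apply/set0Pn; apply/eqP => e; have [_ s1 _] := realization_valP x.
have z v : val x v = 0 by apply: in_face_supp; rewrite e inE.
by move: s1; rewrite big1 // => /eqP; rewrite eq_sym oner_eq0.
Qed.

Lemma supp_near (x : B) : \forall y \near x, (supp x \subset supp y)%SET.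
Proof.
suff : \forall y \near x, forall v, v \in supp x -> v \in supp y.
  by apply: filterS => y h; apply/fintype.subsetP.
have := @filter_forall B V (fun v => [set y : B | v \in supp x -> v \in supp y]) (nbhs x)
  (nbhs_filter x).
apply=> v; have [vx|nvx] := boolP (v \in supp x); last by apply: nearW.
apply/realization_nbhsP; exists `|val x v|; first by rewrite normr_gt0; rewrite inE in vx.
move=> y c _; rewrite inE; apply: contraTneq (c v) => ->.
by rewrite subr0 ltxx.
Qed.

(** Transport along edges between the fibres over the vertices is flat by [tr_flat]. For
    connectedness, each point of [E] is transported to the vertices of the face carrying its image;
    the component reached is locally constant, and [E] is connected. *)
Theorem covering_voltage n : (0 < n)%N -> has_connected_covering B n ->
  exists tau : V -> V -> 'I_n -> 'I_n,
    flat_voltage K tau /\ connected_complex (cover_complex K tau).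
Proof.
move=> n0 [E [p [conE covp shp]]].
have [lam lam0 hch] := chart_exists scK covp.
have [ch chP] := choice hch.
pose l e := (ch e).2; have lP e : chart p lam e (ch e).1 (l e) by exact: chP.
have [N N0 Nlam] : exists2 N : nat, (0 < N)%N & N%:R^-1 < lam / 2.
  have l2 : 0 < lam / 2 by rewrite divr_gt0.
  have /ltr_add_invr[k hk] : 0 < lam / 2 by [].
  by exists k.+1 => //; rewrite add0r in hk.
pose tr := tr p l N.
(* Without vertices in [K] the cover has none either, and the identity serves as voltage. *)
have [[vx vE]|nK] := pselect (exists v, ([set v] \in K)%SET); last first.
  exists (fun _ _ i => i); split.
    by split.
  move=> a b /cover_complexP[aK _]; case: nK; exists a.1.
  by rewrite -imset_set1.
have [vpt vptE] : exists vpt : V -> B, forall v, ([set v] \in K)%SET ->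
    forall w, val (vpt v) w = (w == v)%:R.
  have [b0 _] := vertex_point vE.
  have F v : exists x : B, ([set v] \in K)%SET -> forall w, val x w = (w == v)%:R.
    have [vK|nvK] := pselect (([set v] \in K)%SET : Prop).
      by have [x hx] := vertex_point vK; exists x.
    by exists b0.
  by have [vpt hv] := choice F; exists vpt.
have vpt_face v (s : {set V}) : ([set v] \in K)%SET -> v \in s -> in_face s (vpt v).
  move=> vK vs w ws; rewrite vptE //; case: eqVneq => // e; by rewrite -e (negbTE ws) in vs.
have [idx hidx] := choice (fun v => fibre_enum n0 (shp (vpt v))).
have [pnt hpnt] := choice hidx.
have ppnt v i : p (pnt v i) = vpt v by have [h _ _] := hpnt v; apply: h.
have idxK v i : idx v (pnt v i) = i by have [_ h _] := hpnt v; apply: h.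
have pntK v e : p e = vpt v -> pnt v (idx v e) = e by have [_ _ h] := hpnt v; apply: h.
have trF (s : {set V}) e (y z : B) : s \in K -> in_face s (p e) -> in_face s y -> in_face s z ->
    tr (tr e y) z = tr e z.
  by move=> sK; apply: (tr_flat scK lam0 lP N0 Nlam sK).
have trP (s : {set V}) e (y : B) : s \in K -> in_face s (p e) -> in_face s y -> p (tr e y) = y.
  by move=> sK; apply: (p_tr scK lam0 lP N0 Nlam sK).
have trS e : tr e (p e) = e by apply: (tr_self lP).
pose tau u v i := idx v (tr (pnt u i) (vpt v)).
have dK (s r : {set V}) : r \in K -> (s \subset r)%SET -> s \in K by case: scK => _; apply.
exists tau; split.
  split=> [u i uK|u v w i tK]; rewrite /tau.
    by rewrite -(ppnt u i) trS idxK.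
  have [uK vK wK] : [/\ ([set u] \in K)%SET, ([set v] \in K)%SET & ([set w] \in K)%SET].
    by split; apply: dK tK _; rewrite finset.sub1set !inE eqxx ?orbT.
  have [fu fv fw] : [/\ in_face [set u; v; w]%SET (vpt u), in_face [set u; v; w]%SET (vpt v)
      & in_face [set u; v; w]%SET (vpt w)].
    by split; apply: vpt_face => //; rewrite !inE eqxx ?orbT.
  rewrite pntK; last by apply: (trP _ _ _ tK); rewrite ?ppnt.
  by rewrite (trF _ _ _ _ tK) // ppnt.
set G := edge_rel (cover_complex K tau).
(* The vertex of the cover over [v] reached from [e]; meaningful when [v] lies in the support of
   [p e]. *)
pose at_ e v := (v, idx v (tr e (vpt v))).
have suppK e v : v \in supp (p e) -> ([set v] \in K)%SET.
  by move=> h; apply: dK (supp_mem (p e)) _; rewrite finset.sub1set.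
have indep e v w : v \in supp (p e) -> w \in supp (p e) -> connect G (at_ e v) (at_ e w).
  move=> hv hw; have [<-|nvw] := eqVneq v w; first exact: connect0.
  apply: connect1; apply/andP; split; first by apply: contraNneq nvw => -[->].
  have [vK wK] := (suppK e v hv, suppK e w hw).
  have sK := supp_mem (p e).
  have fe := @in_face_supp (p e).
  have [fv fw] := (vpt_face v _ vK hv, vpt_face w _ wK hw).
  have vwK : ([set v; w] \in K)%SET.
    by apply: dK sK _; apply/fintype.subsetP => z /set2P[] ->.
  apply/cover_complexP; rewrite imsetU !imset_set1 /=; split=> //.
  have key a b : a \in supp (p e) -> b \in supp (p e) -> (at_ e b).2 = tau a b (at_ e a).2.
    move=> ha hb; rewrite /tau /= pntK; last by apply: (trP _ _ _ sK) => //; apply: vpt_face => //; apply: suppK ha.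
    by rewrite (trF _ _ _ _ sK) //; apply: vpt_face => //; [apply: suppK ha | apply: suppK hb].
  by move=> a b /set2P[]-> /set2P[]->; apply: key.
(* Supports can only grow nearby, and over the old support the vertices reached do not change. *)
have near_at e : \forall e' \near e, (supp (p e) \subset supp (p e'))%SET /\
    forall v, v \in supp (p e) -> at_ e' v = at_ e v.
  have c1 : \forall e' \near e, close (lam / 2) (val (p e)) (val (p e')).
    have [cp _] := covp.
    apply: (cp e [set y : B | close (lam / 2) (val (p e)) (val y)]); apply/realization_nbhsP.
    by exists (lam / 2); rewrite ?divr_gt0.
  have c2 : \forall e' \near e, (supp (p e) \subset supp (p e'))%SET.
    have [cp _] := covp.
    by apply: (cp e [set y : B | (supp (p e) \subset supp y)%SET]); apply: supp_near.
  have c3 := l_near lP e.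
  near=> e'.
  have h1 : close (lam / 2) (val (p e)) (val (p e')) by near: e'.
  have h2 : (supp (p e) \subset supp (p e'))%SET by near: e'.
  have h3 : e' = l e (p e') by near: e'.
  split=> // v hv; rewrite /at_; congr (_, idx _ _).
  have sK := supp_mem (p e').
  have fe := in_faceS h2; have fe' := @in_face_supp (p e').
  have fv : in_face (supp (p e')) (vpt v).
    by apply: vpt_face; [exact: suppK hv | exact: (fintype.subsetP h2)].
  have -> : e' = tr e (p e').
    have := tr_near scK lam0 lP N0 Nlam sK fe fe fe' h1.
    by rewrite -/(tr e (p e')) -/(tr e (p e)) trS -h3 => ->.
  exact: trF sK _ _ _.
move=> a b ha hb.
pose S := [set e | exists2 v, v \in supp (p e) & connect G a (at_ e v)].
have Sall e v : S e -> v \in supp (p e) -> connect G a (at_ e v).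
  by move=> [w hw cw] hv; apply: connect_trans cw (indep e w v hw hv).
have oS : open S.
  rewrite openE => e [v hv cv]; rewrite /interior.
  apply: filterS (near_at e) => e' [sub eq_at]; exists v; last by rewrite eq_at.
  exact: (fintype.subsetP sub).
(* For the complement, the larger support at [e'] must be compared with the one at [e]: by [indep],
   reaching one vertex from [e'] means reaching all of them, including an old one. *)
have oSC : open (~` S).
  rewrite openE => e nS; rewrite /interior.
  apply: filterS (near_at e) => e' [sub eq_at] Se'; apply: nS.
  have [v hv] := supp_neq0 (p e); exists v => //.
  by rewrite -eq_at //; apply: Sall => //; apply: (fintype.subsetP sub).
have vert (c : V * 'I_n) : ([set c] \in cover_complex K tau)%SET ->
    ([set c.1] \in K)%SET /\ c = at_ (pnt c.1 c.2) c.1.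
  move=> /cover_complexP[cK _]; rewrite imset_set1 in cK; split=> //.
  by case: c cK => v i /= vK; rewrite /at_ -(ppnt v i) trS idxK.
have supp_vpt v w : ([set v] \in K)%SET -> (w \in supp (vpt v)) = (w == v).
  by move=> vK; rewrite inE vptE // pnatr_eq0; case: (w == v).
have ST : S = setT.
  rewrite -[S]setTI; apply: conE.
  - have [aK ea] := vert a ha; exists (pnt a.1 a.2); split=> //.
    exists a.1; first by rewrite ppnt supp_vpt.
    by rewrite -ea connect0.
  - by exists S.
  - by exists S => //; rewrite -[S]setCK; apply: open_closedC.
have [bK eb] := vert b hb.
have : S (pnt b.1 b.2) by rewrite ST.
move=> [v]; rewrite ppnt supp_vpt // => /eqP->.
by rewrite -eb.
Unshelve. all: by end_near. Qed.

End CoveringVoltage.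

End Lifting.

Local Open Scope ring_scope.

Theorem theorem3p9 (R : realType) (V : finType) (K : {set {set V}}) (d : nat)
    (hd : (2 <= d - 1)%N)
    (hK : normal_pseudomanifold d K)
    (hbal : balanced d K) :
  (forall t : nat, (0 < t)%N ->
     has_connected_covering (realization R K) t ->
     4 * ((t%:R - 1) / t%:R) * ('C(d, 2))%:R <= (g2bar d K)%:~R :> rat) /\
  (betti K 1 <> 0%N -> 4 * ('C(d, 2))%:Z <= g2bar d K).
Proof.
have d2 : (2 < d)%N by move: hd; clear; lia.
have [scK connK _ _ _] := hK.
split=> [t t0 hcov|hb].
  have [tau [flat conn]] := covering_voltage scK t0 hcov.
  have := cover_g2bar d2 t0 hK hbal flat conn.
  rewrite -(ler_int rat) !(rmorphD, rmorphB, rmorphM) /= -!pmulrn => h.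
  have T0 : 0 < t%:R :> rat by rewrite ltr0n.
  rewrite mulrA mulrAC ler_pdivrMr //; move: h; lra.
have [om [oA oC nf]] := betti1_voltage scK hb.
have [v0 [v0K [m m0 loop]]] := closed_walk_exists scK oA connK nf.
case: m m0 loop => // m m0 loop.
(* This [N] gives more than [4 * 'C(d, 2)] sheets. If the bound failed, the integer
   [g2bar d K - 4 * 'C(d, 2)%:Z] would be at most -1, and multiplied by that many sheets it would
   outweigh the constant term. *)
have conn := cyclic_cover_connected scK oC connK (N := (4 * 'C(d, 2))%N) v0K m0 loop.
have flat := cyclic_voltage_flat oC (4 * 'C(d, 2) * m)%N.
have := cover_g2bar d2 (ltn0Sn _) hK hbal flat conn.
case: (lerP (4 * 'C(d, 2)%:Z) (g2bar d K)) => // lt h.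
have le1 : (4 * 'C(d, 2) <= 4 * 'C(d, 2) * m)%N by rewrite leq_pmulr.
have le2 : g2bar d K - 4 * 'C(d, 2)%:Z <= -1 by move: lt; clear; lia.
have n0 : 0 <= (4 * 'C(d, 2) * m).+1%:Z by [].
have := ler_wpM2l n0 le2.
move: h le1; clear; lia.
Qed.
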